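(* Let $R$ be an associative ring with unity. The following are equivalent: (1) $R$ is left pure-semisimple; (2) $(R\text{-Mod},\leq_p)$, the class of all left $R$-modules with pure embeddings, is superstable; (3) $(R\text{-l-pi},\leq_p)$, the class of locally pure-injective left $R$-modules with pure embeddings, is superstable.
   Context: $\leq_p$ is the pure submodule relation. $R$ is left pure-semisimple if every left $R$-module is pure-injective (a direct summand of every module containing it as a pure submodule). A module $M$ is locally pure-injective if every finite tuple of $M$ is contained in a pure-injective pure submodule of $M$. For an AEC $(K,\leq_p)$: $M$ is universal over $N$ if $\|M\|=\|N\|=\lambda$, $N\leq_pM$ and every $N^*\in K$ of size $\lambda$ with $N\leq_pN^*$ embeds purely into $M$ over $N$; a $\lambda$-limit model is the union of an increasing continuous chain $\{M_i:i<\alpha\}$ ($\alpha<\lambda^+$ limit) of models of size $\lambda$ with $M_{i+1}$ universal over $M_i$; the class is superstable if for all sufficiently large $\lambda$, $\lambda$-limit models exist and any two are isomorphic. *)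

(* Defs.v *)
From HB Require Import structures.
From mathcomp Require Import all_boot all_order all_algebra.
Set Implicit Arguments. Unset Strict Implicit. Unset Printing Implicit Defensive.
Import GRing.Theory.
Local Open Scope ring_scope.

Section PureAEC.
Variable R : nzRingType.

Definition is_lin (M N : lmodType R) (f : M -> N) : Prop :=
  forall (a : R) (x y : M), f (a *: x + y) = a *: f x + f y.

Definition pure_emb (N M : lmodType R) (f : N -> M) : Prop :=
  is_lin f /\ injective f /\
  forall (m n : nat) (A : 'M[R]_(m, n)) (b : 'I_m -> N),
    (exists x : 'I_n -> M, forall i, \sum_(j < n) A i j *: x j = f (b i)) ->
    exists y : 'I_n -> N, forall i, \sum_(j < n) A i j *: y j = b i.

Definition pure_injective (M : lmodType R) : Prop :=
  forall (N : lmodType R) (f : M -> N), pure_emb f ->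
    exists g : N -> M, is_lin g /\ forall x, g (f x) = x.

Definition left_pure_semisimple : Prop :=
  forall M : lmodType R, pure_injective M.

Definition locally_pure_injective (M : lmodType R) : Prop :=
  forall (n : nat) (t : 'I_n -> M),
    exists (N : lmodType R) (f : N -> M),
      pure_emb f /\ pure_injective N /\ forall k, exists y, f y = t k.

Definition RMod : lmodType R -> Prop := fun _ => True.
Definition Rlpi : lmodType R -> Prop := locally_pure_injective.

(** Cardinalities: a cardinal is represented by a type. *)
Definition has_size (M : Type) (lam : Type) : Prop :=
  exists f : M -> lam, bijective f.
Definition card_le (A B : Type) : Prop := exists f : A -> B, injective f.

Variable K : lmodType R -> Prop.

Definition universal_over (lam : Type) (N M : lmodType R) (e : N -> M) : Prop :=
  K N /\ K M /\ has_size N lam /\ has_size M lam /\ pure_emb e /\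
  forall (Ns : lmodType R) (es : N -> Ns),
    K Ns -> has_size Ns lam -> pure_emb es ->
    exists h : Ns -> M, pure_emb h /\ forall x, h (es x) = e x.

(** Ordinals alpha < lam^+ that are limit ordinals: well-ordered index types
    (I, lt) of cardinality <= lam, nonempty and without a maximum. *)
Definition limit_ordinal_below_succ (lam : Type) (I : Type) (lt : I -> I -> Prop)
  : Prop :=
  well_founded lt /\
  (forall i, ~ lt i i) /\
  (forall i j k, lt i j -> lt j k -> lt i k) /\
  (forall i j, lt i j \/ i = j \/ lt j i) /\
  inhabited I /\
  (forall i, exists j, lt i j) /\
  card_le I lam.

Definition ord_le (I : Type) (lt : I -> I -> Prop) (i j : I) := lt i j \/ i = j.
Definition is_limit_point (I : Type) (lt : I -> I -> Prop) (i : I) :=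
  (exists j, lt j i) /\ forall j, lt j i -> exists k, lt j k /\ lt k i.
Definition is_succ_of (I : Type) (lt : I -> I -> Prop) (i j : I) :=
  lt i j /\ ~ (exists k, lt i k /\ lt k j).

(** M is a lam-limit model in (K, <=_p): the union of an increasing continuous
    chain (M_i, f_ij) indexed by a limit ordinal alpha < lam^+, of models of
    size lam, with M_{i+1} universal over M_i. The union is expressed by
    compatible pure embeddings g_i : M_i -> M that jointly cover M; continuity
    at a limit i says M_i is the union of the M_j, j < i. *)
Definition limit_model (lam : Type) (M : lmodType R) : Prop :=
  K M /\
  exists (I : Type) (lt : I -> I -> Prop)
         (Ms : I -> lmodType R) (f : forall i j : I, Ms i -> Ms j)
         (g : forall i : I, Ms i -> M),
    limit_ordinal_below_succ lam lt /\
    (forall i, K (Ms i) /\ has_size (Ms i) lam) /\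
    (forall i j, ord_le lt i j -> pure_emb (f i j)) /\
    (forall i x, f i i x = x) /\
    (forall i j k x, ord_le lt i j -> ord_le lt j k ->
        f j k (f i j x) = f i k x) /\
    (forall i, is_limit_point lt i ->
        forall x : Ms i, exists j, lt j i /\ exists y, f j i y = x) /\
    (forall i j, is_succ_of lt i j -> universal_over lam (f i j)) /\
    (forall i, pure_emb (g i)) /\
    (forall i j x, ord_le lt i j -> g j (f i j x) = g i x) /\
    (forall x : M, exists i y, g i y = x).

Definition superstable : Prop :=
  exists mu : Type, forall lam : Type, card_le mu lam ->
    (exists M : lmodType R, limit_model lam M) /\
    (forall M1 M2 : lmodType R, limit_model lam M1 -> limit_model lam M2 ->
       exists h : M1 -> M2, is_lin h /\ bijective h).

End PureAEC.

(* Main.v *)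
Require Import Defs.
From HB Require Import structures.
From mathcomp Require Import all_boot all_order all_algebra all_field.
From mathcomp Require Import boolp classical_sets functions cardinality.
Import Defs GRing.Theory Num.Theory.
Set Implicit Arguments. Unset Strict Implicit. Unset Printing Implicit Defensive.

(** Write pp(s, M) for the subgroup of a module M defined by a pp-formula s in one free variable.

If R is pure-semisimple, every pure embedding splits. Let F be the direct sum of all finitely presented modules and V = F^(L) for an infinite set L with |L| >= |R|. Every module of cardinality at most |L| is the image of V under a map with pure kernel, hence is a direct summand of V; by Eilenberg's swindle every such module is absorbed by W = V^(N). So every L-limit model is isomorphic to W, and W itself is the limit model obtained from the chain V, V^2, V^3, ...

Conversely, if some module is not pure-injective, then some M has an infinite strictly descending chain pp(s_n, M). Choose a cardinal L with L^omega > L. If an L-limit model exists, there are modules N0 < N1 < N2 of cardinality L, each universal over the preceding one, and N1 contains M^(N * L) as a pure submodule. The character bidual of N1 is algebraically compact, so it realises the L^omega distinct types over N1 given by the formal sums sum_n a_n e_(n, eta n), for eta : N -> L, with a_n in pp(s_n, M) but not in pp(s_(n+1), M). By a Löwenheim-Skolem argument inside the bidual, each of these types is realised in a locally pure-injective pure extension of N1 of cardinality L, hence in N2, which is too small. *)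

Local Open Scope classical_set_scope.
Local Open Scope card_scope.

(** * Zorn's lemma and cardinal arithmetic *)


(** The choice L^omega > L creates the main difficulty. Any algebraically compact pure extension of
    N1 realises all L^omega types at once, so it has more than L elements; a module of cardinality L
    that contains N1 and realises one of the types therefore cannot itself be pure-injective. It is
    made only locally pure-injective: each finite tuple is closed separately under solutions of
    linear systems and common points of cosets, and the closure of one tuple has a cardinality
    bounded in terms of R alone. Since this module belongs to both classes, a single argument gives
    (2) => (1) and (3) => (1), while under (1) the two classes coincide. Two universal steps are
    taken because they do different work: N1 receives the parameters e_(n, l), and N2 realises the
    types over them. The bidual stands in for the pure-injective hull: it is explicit, and its size
    is harmless since only a small piece of it is kept. *)

Lemma chain_seq (T : Type) (I : eqType) (F : set (set T)) (s : seq I) (x : I -> T) :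
  F !=set0 -> total_on F subset ->
  (forall k, k \in s -> (\bigcup_(X in F) X) (x k)) ->
  exists X, F X /\ forall k, k \in s -> X (x k).
Proof.
move=> [X0 FX0] totF; elim: s => [|k s IHs] sF; first by exists X0.
have [|X [FX Xs]] := IHs; first by move=> j js; apply: sF; rewrite inE js orbT.
have [Y FY Yk] := sF k (mem_head _ _).
have [XY|YX] := totF _ _ FX FY.
  exists Y; split=> // j; rewrite inE => /orP[/eqP->//|js]; exact/XY/Xs.
exists X; split=> // j; rewrite inE => /orP[/eqP->//|js]; [exact: YX|exact: Xs].
Qed.

Lemma chain_pair (T : Type) (F : set (set T)) (x y : T) :
  total_on F subset -> (\bigcup_(X in F) X) x -> (\bigcup_(X in F) X) y ->
  exists X, [/\ F X, X x & X y].
Proof.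
move=> totF Fx Fy; have Fn0 : F !=set0 by case: Fx => X FX _; exists X.
have [|X [FX Xxy]] := @chain_seq T bool F [:: true; false] (fun b => if b then x else y) Fn0 totF.
  by case.
by exists X; split=> //; [exact: (Xxy true)|exact: (Xxy false)].
Qed.

Lemma zorn_above (T : Type) (P : set (set T)) (A0 : set T) :
  P A0 ->
  (forall F : set (set T), F !=set0 -> F `<=` P -> (forall X, F X -> A0 `<=` X) ->
     total_on F subset -> P (\bigcup_(X in F) X)) ->
  exists A, [/\ A0 `<=` A, P A & forall B, A `<=` B -> P B -> B `<=` A].
Proof.
move=> PA0 chainP.
(* [Zorn_bigcup] also asks about the empty chain, whose union is empty and need not satisfy [P];
   hence the extra disjunct, which maximality removes at the end. *)
pose Q (X : set T) := X = set0 \/ (P X /\ A0 `<=` X).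
have [F FQ totF|A [QA maxA]] := @Zorn_bigcup T Q.
  pose G := [set X | F X /\ X != set0].
  have FG : \bigcup_(X in F) X = \bigcup_(X in G) X.
    apply/seteqP; split=> x [X]; last by case=> FX _; exists X.
    by move=> FX Xx; exists X => //; split=> //; apply/set0P; exists x.
  rewrite FG; have [[X GX]|G0] := pselect (exists X, G X); last first.
    by left; apply/seteqP; split=> // x [X GX]; case: G0; exists X.
  have GP Y : G Y -> P Y /\ A0 `<=` Y by case=> /FQ[->|//]; rewrite eqxx.
  right; split; last by move=> x A0x; exists X => //; exact: (GP X GX).2.
  apply: chainP; first by exists X.
  - by move=> Y /GP[].
  - by move=> Y /GP[].
  - by move=> Y Z [FY _] [FZ _]; exact: totF.
have Amax B : A `<=` B -> Q B -> B `<=` A.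
  move=> AB QB x Bx; apply: contrapT => nAx; apply: (maxA B) => //.
  by split=> // BA; exact/nAx/BA.
have [PA AA0] : P A /\ A0 `<=` A.
  case: QA => // A0'; have A00 : A0 `<=` A by apply: Amax; [rewrite A0'; exact: sub0set|by right; split].
  suff <- : A0 = A by split.
  by apply/seteqP; split=> //; rewrite A0'.
exists A; split=> // B AB PB; apply: Amax => //; right; split=> //.
exact: subset_trans AB.
Qed.

Lemma cardle_refl (A : Type) : card_le A A.
Proof. by exists id. Qed.

Lemma cardle_trans (B A C : Type) : card_le A B -> card_le B C -> card_le A C.
Proof. by move=> [f fI] [g gI]; exists (g \o f); exact: inj_comp. Qed.

Lemma cardle_prod (A B A' B' : Type) :
  card_le A A' -> card_le B B' -> card_le (A * B) (A' * B').
Proof.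
move=> [f fI] [g gI]; exists (fun x => (f x.1, g x.2)).
by move=> [x1 x2] [y1 y2] [/fI-> /gI->].
Qed.

Lemma has_size_le (A B : Type) : has_size A B -> card_le A B.
Proof. by move=> [f /bij_inj]; exists f. Qed.

Lemma has_size_ge (A B : Type) : has_size A B -> card_le B A.
Proof. by move=> [f [g fK gK]]; exists g; exact: can_inj gK. Qed.

Lemma cardle_antisym (A B : Type) : card_le A B -> card_le B A -> has_size A B.
Proof.
elim/Ppointed: B => B [f fI] [g gI].
  by exists f; exists g => x; exfalso; [exact: (no (f x))|exact: (no x)].
have fA : {in [set: A] &, injective f} by move=> x y _ _; exact: fI.
have gB : {in [set: B] &, injective g} by move=> x y _ _; exact: gI.
have : [set: A] #= [set: B].
  apply: Cantor_Bernstein.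
    by rewrite -(card_le_eql (inj_card_eq fA)); exact: subset_card_le.
  by rewrite -(card_le_eql (inj_card_eq gB)); exact: subset_card_le.
by move=> /card_set_bijP[h]; rewrite setTT_bijective; exists h.
Qed.

Lemma cardle_decode (A B : Type) (a : A) : card_le A B ->
  exists f : B -> A, forall x, exists b, f b = x.
Proof.
move=> [g gI].
exists (fun b => if pselect (exists x, g x = b) is left e then projT1 (cid e) else a).
move=> x; exists (g x); case: pselect => [e|[]]; last by exists x.
by apply: gI; exact: projT2 (cid e).
Qed.

(* A maximal partial injection is either everywhere defined or onto. *)
Lemma cardle_total (A B : Type) : card_le A B \/ card_le B A.
Proof.
pose P (G : set (A * B)) := forall p q, G p -> G q -> (p.1 = q.1 <-> p.2 = q.2).
have [|F _ FP _ totF p q Fp Fq|G [_ PG maxG]] := @zorn_above _ P set0.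
- by [].
- by have [X [/FP PX Xp Xq]] := chain_pair totF Fp Fq; exact: PX.
have [[a na]|dG] := pselect (exists a, ~ exists b, G (a, b)); last first.
  have /choice[f Gf] : forall a, exists b, G (a, b).
    by move=> a; apply: contrapT => na; apply: dG; exists a.
  by left; exists f => x y fxy; apply/(PG _ _ (Gf x) (Gf y)).
have [[b nb]|cG] := pselect (exists b, ~ exists a, G (a, b)); last first.
  have /choice[f Gf] : forall b, exists a, G (a, b).
    by move=> b; apply: contrapT => nb; apply: cG; exists b.
  by right; exists f => x y fxy; apply/(PG _ _ (Gf x) (Gf y)).
case: (na); exists b; apply: (maxG (G `|` [set (a, b)])); [by left| |by right].
move=> [x y] [x' y'] /= [Gp|[-> ->]] [Gq|[-> ->]] //; first exact: (PG _ _ Gp Gq).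
- by split=> e; [case: na; exists y; rewrite -e|case: nb; exists x; rewrite -e].
- by split=> e; [case: na; exists y'; rewrite e|case: nb; exists x'; rewrite e].
Qed.

(* A maximal injection [A * A -> A] with [A] an infinite part of [L] has [A] equipotent to [L]: otherwise the complement of [A] contains a copy [f A] of [A], and the pairs of elements of [A + f A] not in [A * A] can be coded in [f A]. *)
Lemma cardle_square (L : Type) : card_le nat L -> card_le (L * L) L.
Proof.
move=> [i iI].
pose D (G : set (L * L * L)) x := exists z, G (x, x, z).
pose P (G : set (L * L * L)) :=
  [/\ forall x y z, G (x, y, z) -> [/\ D G x, D G y & D G z],
      forall x y, D G x -> D G y -> exists z, G (x, y, z) &
      forall p q, G p -> G q -> (p.1 = q.1 <-> p.2 = q.2)].
pose G0 : set (L * L * L) := [set p | exists m n, p = (i m, i n, i (pickle (m, n)))].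
have DG0 m : D G0 (i m) by exists (i (pickle (m, m))); exists m, m.
have pickleI : injective (@pickle (nat * nat)%type) by exact: pcan_inj (@pickleK _).
have [||G [G0G [G1 G2 G3] maxG]] := @zorn_above _ P G0.
- split.
  + by move=> x y z [m [n [-> -> ->]]].
  + move=> x y [z [m [_ [-> _ _]]]] [z' [n [_ [-> _ _]]]].
    by exists (i (pickle (m, n))), m, n.
  + move=> _ _ [m [n ->]] [m' [n' ->]] /=; split; first by move=> [/iI-> /iI->].
    by move=> /iI/pickleI[-> ->].
- move=> F [X0 FX0] FP _ totF; split.
  + move=> x y z [X FX Xxyz]; have [X1 _ _] := FP X FX.
    have [[u Xu] [v Xv] [w Xw]] := X1 _ _ _ Xxyz.
    by split; [exists u|exists v|exists w]; exists X.
  + move=> x y [u Fu] [v Fv]; have [X [FX Xu Xv]] := chain_pair totF Fu Fv.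
    have [_ X2 _] := FP X FX; have [z Xz] := X2 x y (ex_intro _ u Xu) (ex_intro _ v Xv).
    by exists z, X.
  + move=> p q Fp Fq; have [X [/FP[_ _ X3] Xp Xq]] := chain_pair totF Fp Fq.
    exact: X3.
pose A := {x | D G x}; pose B := {x | ~ D G x}.
have AAA : card_le (A * A) A.
  have h (p : A * A) : exists z : A, G (sval p.1, sval p.2, sval z).
    case: p => [[x Dx] [y Dy]]; have [z Gz] := G2 x y Dx Dy.
    have [_ _ Dz] := G1 _ _ _ Gz; by exists (exist _ z Dz).
  have [f fG] := choice h; exists f => -[[x Dx] [y Dy]] [[x' Dx'] [y' Dy']] e.
  have [_] := G3 _ _ (fG (exist _ x Dx, exist _ y Dy)) (fG (exist _ x' Dx', exist _ y' Dy')).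
  by rewrite e => /(_ erefl) /= [ex ey]; congr (_, _); exact: eq_exist.
have iD n : D G (i n) by case: (DG0 n) => z /G0G; exists z.
have bA : card_le (bool * A) A.
  apply: cardle_trans AAA; apply: cardle_prod; last exact: cardle_refl.
  exists (fun b => exist (D G) (i b) (iD b)) => b c /(congr1 sval) /iI.
  by case: b c => [] [].
have LA : card_le A L by exists sval => -[x Dx] [y Dy] /= xy; exact: eq_exist.
have [[f fI]|BA] := cardle_total A B; last first.
  have LeA : card_le L A.
    apply: cardle_trans bA; have [f fI] := BA.
    exists (fun x => match pselect (D G x) with
      | left d => (true, exist _ x d) | right d => (false, f (exist _ x d)) end).
    move=> x y; case: pselect => dx; case: pselect => dy //; first by case.
    by move=> [/fI[]].
  exact: cardle_trans (cardle_prod LeA LeA) (cardle_trans AAA LA).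
have [c cI] : card_le ((bool * A) * (bool * A)) A.
  exact: cardle_trans (cardle_prod bA bA) AAA.
pose v (p : bool * A) : L := if p.1 then sval (f p.2) else sval p.2.
have vI : injective v.
  move=> [[] a] [[] b]; rewrite /v /= => e.
  - by congr (_, _); apply: fI; case: (f a) (f b) e => [x ?] [y ?] /= xy; exact: eq_exist.
  - by case: (f a) e => x nx /= e; case: nx; rewrite e; exact: (svalP b).
  - by case: (f b) e => x nx /= e; case: nx; rewrite -e; exact: (svalP a).
  - by congr (_, _); case: a b e => [x ?] [y ?] /= xy; exact: eq_exist.
pose N : set (L * L * L) := [set p | exists q : (bool * A) * (bool * A),
  q.1.1 || q.2.1 /\ p = (v q.1, v q.2, sval (f (c q)))].
have DN p : D (G `|` N) (v p).
  case: p => [[] a]; first by exists (sval (f (c ((true, a), (true, a))))); right; exists (true, a, (true, a)).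
  by case: (svalP a) => z Gz; exists z; left.
have ND x : D (G `|` N) x -> exists p, v p = x.
  move=> [z [Gz|[[p q] [_ [-> _ _]]]]]; last by exists p.
  by exists (false, exist _ x (ex_intro _ z Gz)).
have a0 : A := exist _ (i 0%N) (iD 0%N).
suff GN : P (G `|` N).
  pose q0 := (true, a0).
  have Gz : G (v q0, v q0, sval (f (c (q0, q0)))).
    by apply: (maxG _ (@subsetUl _ _ _) GN); right; exists (q0, q0).
  by have [_ _ Dz] := G1 _ _ _ Gz; case: (svalP (f (c (q0, q0)))).
split.
- move=> x y z [/G1[Dx Dy Dz]|].
    have DD u : D G u -> D (G `|` N) u by move=> [w Gw]; exists w; left.
    by split; exact: DD.
  move=> [[p q] [_ [-> -> ->]]]; split=> //; exact: (DN (true, c (p, q))).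
- move=> x y /ND[p <-] /ND[q <-]; have [pq|npq] := boolP (p.1 || q.1).
    by exists (sval (f (c (p, q)))); right; exists (p, q).
  case: p q npq => [[] a] [[] b] //= _.
  by have [z Gz] := G2 _ _ (svalP a) (svalP b); exists z; left.
have sep p q r : G p -> q.1 || r.1 ->
    (p.1 = (v q, v r) <-> p.2 = sval (f (c (q, r)))).
  move: p => [[x y] z] /G1[Dx Dy Dz] qr; split=> /= e.
    case: e Dx Dy => -> -> {x y}; case: q r qr => [[] a] [[] b] //= _ h1 h2;
    by [case: (svalP (f a))|case: (svalP (f b))].
  by case: (svalP (f (c (q, r)))); rewrite -e.
move=> p p' [Gp|[[q r] /= [qr ->]]] [Gp'|[[q' r'] /= [qr' ->]]]; first exact: G3.
- exact: sep.
- by have [h1 h2] := sep p' q r Gp' qr; split=> [/esym/h1|/esym/h2].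
split=> [[/vI-> /vI->]//|e].
have : f (c (q, r)) = f (c (q', r')).
  by case: (f _) (f _) e => [x ?] [y ?] /= xy; exact: eq_exist.
by move=> /fI/cI[-> ->].
Qed.

Lemma cardle_seq (L : Type) : card_le nat L -> card_le (seq L) L.
Proof.
move=> Linf; have [p pI] := cardle_square Linf; have [i iI] := Linf.
pose enc := foldr (fun x y => p (x, y)) (i 0%N).
exists (fun s => p (i (size s), enc s)) => s t /pI[/iI].
elim: s t => [|x s IHs] [|y t] //= [/IHs{}IHs] /pI[-> /IHs->] //.
Qed.

Lemma cardle_nat_prod (L : Type) : card_le nat L -> card_le (nat * L) L.
Proof.
move=> Linf; apply: cardle_trans (cardle_square Linf).
by apply: cardle_prod Linf _; exact: cardle_refl.
Qed.

Fixpoint beth_tower (A : Type) (n : nat) : Type :=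
  if n is n'.+1 then set (beth_tower A n') else A.

(** Power sets iterated omega times give a cardinal above [A] of countable cofinality, which is what
    makes L^omega > L. *)
Definition beth_omega (A : Type) : Type := {n & beth_tower A n}.

Lemma beth_omega_ge (A : Type) : card_le A (beth_omega A).
Proof.
exists (fun a => existT (beth_tower A) 0%N a) => a b e.
exact: (eq_from_Tagged (T_ := beth_tower A) e).
Qed.

(* König: a coordinate-wise diagonal argument over the levels of the tower. *)
Lemma beth_omega_koenig (A : Type) : ~ card_le (nat -> beth_omega A) (beth_omega A).
Proof.
move=> [F FI]; set L := beth_omega A in F FI.
(* The sequences sent to level [n] are at most as many as [beth_tower A n], so their [n]-th entries
   miss some point of the next level. A sequence of missed points then has no level to go to. *)
have h n : exists x : L, ~ exists (b : beth_tower A n) (e : nat -> L),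
    F e = existT _ n b /\ e n = x.
  apply: contrapT => H.
  have {}H (X : set (beth_tower A n)) : exists b e,
      F e = existT (beth_tower A) n b /\ e n = existT (beth_tower A) n.+1 X.
    by apply: contrapT => H1; apply: H; exists (existT (beth_tower A) n.+1 X).
  have /choice[g gP] := H.
  pose Z : set (beth_tower A n) := [set b | exists X, g X = b /\ ~ X b].
  have [] := pselect (Z (g Z)) => [[X [gX nX]]|nZ]; last by apply: (nZ); exists Z.
  have [e [Fe en]] := gP X; have [e' [Fe' en']] := gP Z.
  have ee' : e = e' by apply: FI; rewrite Fe Fe' gX.
  move: en; rewrite ee' en' => /(@eq_from_Tagged _ (beth_tower A) _ _ _) XZ; apply: (nX); rewrite -XZ.
  by exists X.
have [e eP] := choice h; case FE: (F e) => [n b]; apply: (eP n).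
by exists b, e.
Qed.

Local Open Scope ring_scope.

(** * Linear systems, pp-subgroups and algebraic compactness *)

Section LinearMaps.
Variable R : nzRingType.
Implicit Types M N P : lmodType R.

Lemma is_lin0 M N (f : M -> N) : is_lin f -> f 0 = 0.
Proof.
by move=> fl; have := fl 1 0 0; rewrite !scale1r addr0 -[LHS]addr0 => /addrI.
Qed.

Lemma is_linZ M N (f : M -> N) a x : is_lin f -> f (a *: x) = a *: f x.
Proof. by move=> fl; rewrite -[a *: x]addr0 fl is_lin0// addr0. Qed.

Lemma is_linD M N (f : M -> N) x y : is_lin f -> f (x + y) = f x + f y.
Proof. by move=> fl; rewrite -[x]scale1r fl !scale1r. Qed.

Lemma is_linB M N (f : M -> N) x y : is_lin f -> f (x - y) = f x - f y.
Proof. by move=> fl; rewrite -scaleN1r addrC fl scaleN1r addrC. Qed.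

Lemma is_lin_sum M N (f : M -> N) (I : Type) (s : seq I) (P : pred I) (F : I -> M) :
  is_lin f -> f (\sum_(i <- s | P i) F i) = \sum_(i <- s | P i) f (F i).
Proof.
move=> fl; apply: (big_morph f (op1 := +%R) (id1 := 0)) => [x y|].
  exact: is_linD.
exact: is_lin0.
Qed.

Lemma is_lin_comp M N P (g : N -> P) (f : M -> N) :
  is_lin g -> is_lin f -> is_lin (g \o f).
Proof. by move=> gl fl a x y; rewrite /= fl gl. Qed.

Lemma is_lin_inj M N (f : M -> N) : is_lin f -> (forall x, f x = 0 -> x = 0) -> injective f.
Proof.
move=> fl f0 x y fxy; apply/eqP; rewrite -subr_eq0; apply/eqP/f0.
by rewrite is_linB// fxy subrr.
Qed.

Lemma pure_split M N (f : M -> N) (g : N -> M) :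
  is_lin f -> is_lin g -> cancel f g -> pure_emb f.
Proof.
move=> fl gl fK; split=> //; split; first exact: can_inj fK.
move=> m n A b [x Ax]; exists (g \o x) => i.
rewrite -[RHS]fK -Ax is_lin_sum//; apply: eq_bigr => j _.
by rewrite is_linZ.
Qed.

Lemma pure_comp M N P (g : N -> P) (f : M -> N) :
  pure_emb g -> pure_emb f -> pure_emb (g \o f).
Proof.
move=> [gl [gI gp]] [fl [fI fp]]; split; first exact: is_lin_comp.
split; first exact: inj_comp.
by move=> m n A b /gp/fp.
Qed.

Lemma pure_factor M N P (g : N -> P) (f : M -> N) (k : M -> P) :
  is_lin f -> is_lin g -> pure_emb k -> (forall x, g (f x) = k x) -> pure_emb f.
Proof.
move=> fl gl [kl [kI kp]] gf; split=> //; split.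
  by move=> x y fxy; apply: kI; rewrite -!gf fxy.
move=> m n A b [x Ax]; apply: kp; exists (g \o x) => i.
rewrite -gf -Ax is_lin_sum//; apply: eq_bigr => j _.
by rewrite is_linZ.
Qed.

Lemma pure_id M : pure_emb (id : M -> M).
Proof. exact: (@pure_split M M id id). Qed.

End LinearMaps.

Section LinearSystems.
Variable R : nzRingType.
Implicit Types M N : lmodType R.

(* [sum_k a_k X_(i_k)] is encoded by the list of the pairs [(a_k, i_k)]. *)
Definition lterm : Type := seq (R * nat).
Definition lsys : Type := seq (seq (R * nat)).

Definition leval M (t : lterm) (h : nat -> M) : M := \sum_(p <- t) p.1 *: h p.2.

Definition lsol M (s : lsys) (h : nat -> M) : Prop :=
  forall t, t \in s -> leval t h = 0.

Definition lren (r : nat -> nat) (t : lterm) : lterm := [seq (p.1, r p.2) | p <- t].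

(* The subgroup defined by the pp-formula whose free variable is [X_0]. *)
Definition pp M (s : lsys) (x : M) : Prop := exists h, lsol s h /\ h 0%N = x.

Lemma leval_ren M r t (h : nat -> M) : leval (lren r t) h = leval t (h \o r).
Proof. by rewrite /leval big_map. Qed.

Lemma lsol_ren M r s (h : nat -> M) : lsol (map (lren r) s) h <-> lsol s (h \o r).
Proof.
split=> hs t ts; first by rewrite -leval_ren; apply: hs; exact: map_f.
by case/mapP: ts => u us ->; rewrite leval_ren hs.
Qed.

Lemma lsol_cat M s1 s2 (h : nat -> M) : lsol (s1 ++ s2) h <-> lsol s1 h /\ lsol s2 h.
Proof.
split=> [hs|[h1 h2] t]; last by rewrite mem_cat => /orP[/h1|/h2].
by split=> t ts; apply: hs; rewrite mem_cat ts ?orbT.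
Qed.

Lemma leval_lin M N (f : M -> N) t h : is_lin f -> f (leval t h) = leval t (f \o h).
Proof.
move=> fl; rewrite /leval is_lin_sum//; apply: eq_bigr => p _.
by rewrite is_linZ.
Qed.

Lemma levalB M t (h k : nat -> M) : leval t (fun i => h i - k i) = leval t h - leval t k.
Proof.
by rewrite /leval -sumrB; apply: eq_bigr => p _; rewrite scalerBr.
Qed.

Lemma leval1 M k (h : nat -> M) : leval [:: (1, k)] h = h k.
Proof. by rewrite /leval big_seq1 scale1r. Qed.

Lemma lsol_lin M N (f : M -> N) s h : is_lin f -> lsol s h -> lsol s (f \o h).
Proof. by move=> fl hs t /hs ht; rewrite -leval_lin// ht is_lin0. Qed.

Lemma lsolB M s (h k : nat -> M) : lsol s h -> lsol s k -> lsol s (fun i => h i - k i).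
Proof. by move=> hs ks t ts; rewrite levalB hs// ks// subrr. Qed.

Lemma pp_lin M N (f : M -> N) s x : is_lin f -> pp s x -> pp s (f x).
Proof.
by move=> fl [h [hs <-]]; exists (f \o h); split=> //; exact: lsol_lin.
Qed.

Lemma ppB M s (x y : M) : pp s x -> pp s y -> pp s (x - y).
Proof.
move=> [h [hs <-]] [k [ks <-]]; exists (fun i => h i - k i); split=> //.
exact: lsolB.
Qed.

Lemma pp0 M s : pp s (0 : M).
Proof.
exists (fun=> 0); split=> // t _; rewrite /leval big1// => p _.
by rewrite scaler0.
Qed.

Lemma ppN M s (x : M) : pp s x -> pp s (- x).
Proof. by move=> px; rewrite -sub0r; apply: ppB px; exact: pp0. Qed.

Lemma ppD M s (x y : M) : pp s x -> pp s y -> pp s (x + y).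
Proof. by move=> px py; rewrite -[y]opprK; apply: ppB px _; exact: ppN. Qed.

(** Renamings that put two systems side by side: they share only the free variable [0], and the
    parity in their names is that of the predecessor of the new index. *)
Definition evens (k : nat) : nat := if k is k'.+1 then k'.*2.+1 else 0%N.
Definition odds (k : nat) : nat := if k is k'.+1 then k'.*2.+2 else 0%N.
Definition interleave (T : Type) (g h : nat -> T) (k : nat) : T :=
  if k is k'.+1 then (if odd k' then h k'./2.+1 else g k'./2.+1) else g 0%N.

Lemma interleave_evens T (g h : nat -> T) : interleave g h \o evens = g.
Proof. by apply/funext => -[|k] //=; rewrite odd_double doubleK. Qed.

Lemma interleave_odds T (g h : nat -> T) : g 0%N = h 0%N -> interleave g h \o odds = h.
Proof.
by move=> gh; apply/funext => -[|k] //=; rewrite odd_double /= uphalf_double.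
Qed.

Definition lconj (s1 s2 : lsys) : lsys := map (lren evens) s1 ++ map (lren odds) s2.

Lemma pp_conj M s1 s2 (x : M) : pp (lconj s1 s2) x <-> pp s1 x /\ pp s2 x.
Proof.
split=> [[h [/lsol_cat[/lsol_ren h1 /lsol_ren h2] hx]]|[[g [gs gx]] [h [hs hx]]]].
  by split; [exists (h \o evens)|exists (h \o odds)].
have gh : g 0%N = h 0%N by rewrite gx hx.
exists (interleave g h); split=> //; apply/lsol_cat; split; apply/lsol_ren.
  by rewrite interleave_evens.
by rewrite interleave_odds.
Qed.

Lemma pp_conj_seq M (l : seq lsys) (x : M) :
  pp (foldr lconj [::] l) x <-> (forall s, s \in l -> pp s x).
Proof.
elim: l => [|s l IHl] /=; first by split=> // _; exists (fun=> x).
rewrite pp_conj IHl; split=> [[ps pl] u|pl].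
  by rewrite inE => /orP[/eqP->|/pl].
by split=> [|u ul]; apply: pl; rewrite inE ?eqxx ?ul ?orbT.
Qed.

Lemma lterm_bound (l : seq lterm) :
  exists n, forall t p, t \in l -> p \in t -> (p.2 < n)%N.
Proof.
exists (\max_(t <- l) \max_(p <- t) p.2).+1 => t p tl pt; rewrite ltnS.
apply: leq_trans (leq_bigmax_seq (F := fun t : lterm => \max_(p <- t) p.2) t tl isT).
exact: (leq_bigmax_seq (F := fun p : R * nat => p.2) p).
Qed.

Lemma pure_solve N M (f : N -> M) (E : seq (lterm * N)) : pure_emb f ->
  (exists h, forall e, e \in E -> leval e.1 h = f e.2) ->
  exists h, forall e, e \in E -> leval e.1 h = e.2.
Proof.
move=> [fl [_ fp]] [h hE].
have [n nP] := lterm_bound [seq e.1 | e <- E].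
have En e p : e \in E -> p \in e.1 -> (p.2 < n)%N.
  by move=> eE; apply: nP; exact: map_f.
(* A variable may occur several times in a term, so an entry sums all its coefficients. *)
pose A := \matrix_(i < size E, j < n)
  \sum_(p <- (tnth (in_tuple E) i).1 | p.2 == j) p.1.
have evA (L : lmodType R) (k : 'I_n -> L) i :
    \sum_(j < n) A i j *: k j =
    leval (tnth (in_tuple E) i).1 (fun v => if insub v is Some j then k j else 0).
  have iE : tnth (in_tuple E) i \in E by exact: mem_tnth.
  rewrite /leval; under eq_bigr do rewrite mxE scaler_suml big_mkcond.
  rewrite exchange_big big_seq [RHS]big_seq /=; apply: eq_bigr => p pe.
  have pn := En _ _ iE pe; rewrite (bigD1 (Ordinal pn))//= eqxx insubT.
  rewrite big1 ?addr0// => j jp; case: eqP => // e; case/eqP: jp; exact: val_inj.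
have [|y yE] := fp _ _ A (fun i => (tnth (in_tuple E) i).2).
  exists (h \o val) => i; have iE : tnth (in_tuple E) i \in E by exact: mem_tnth.
  rewrite evA -hE// /leval big_seq [RHS]big_seq; apply: eq_bigr => p pe.
  by rewrite (insubT (fun v => v < n)%N (En _ _ iE pe)).
exists (fun v => if insub v is Some j then y j else 0) => e eE.
have [i ->] : exists i, e = tnth (in_tuple E) i by apply/tnthP.
by rewrite -evA; exact: yE.
Qed.

Lemma pure_of_solve N M (f : N -> M) : is_lin f -> injective f ->
  (forall E : seq (lterm * N),
    (exists h, forall e, e \in E -> leval e.1 h = f e.2) ->
    exists h, forall e, e \in E -> leval e.1 h = e.2) -> pure_emb f.
Proof.
move=> fl fI fE; split=> //; split=> // m n A b [x Ax].
pose E := [seq ([seq (A i j, val j) | j <- enum 'I_n], b i) | i <- enum 'I_m].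
have evA (L : lmodType R) (h : nat -> L) i :
    leval [seq (A i j, val j) | j <- enum 'I_n] h = \sum_j A i j *: h (val j).
  by rewrite /leval big_map big_enum.
have [|h hE] := fE E.
  exists (fun v => if insub v is Some j then x j else 0) => _ /mapP[i _ ->] /=.
  by rewrite evA -Ax; apply: eq_bigr => j _; rewrite valK.
exists (h \o val) => i; rewrite /= -evA.
by apply: (hE (_, _)); apply/mapP; exists i => //; rewrite mem_enum.
Qed.

Lemma pp_pure N M (f : N -> M) s x : pure_emb f -> pp s (f x) -> pp s x.
Proof.
move=> fp [h [hs hx]]; have fl := fp.1.
have [|k kE] := @pure_solve _ _ f (([:: (1, 0%N)], x) :: [seq (t, 0) | t <- s]) fp.
  exists h => e; rewrite inE => /orP[/eqP->|/mapP[t ts ->]] /=.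
    by rewrite leval1.
  by rewrite hs// is_lin0.
exists k; split; last by have := kE _ (mem_head _ _); rewrite leval1.
by move=> t ts; apply: (kE (t, 0)); rewrite inE map_f ?orbT.
Qed.

(** Compactness in one unknown: [Psi s m] puts the coset of [m] modulo pp(s, M) into the family. *)
Definition alg_compact M : Prop := forall Psi : lsys -> M -> Prop,
  (forall l : seq (lsys * M), exists x, forall c, c \in l -> Psi c.1 c.2 -> pp c.1 (x - c.2)) ->
  exists x, forall s m, Psi s m -> pp s (x - m).

Definition pp_chain M (s : nat -> lsys) (a : nat -> M) : Prop := forall n,
  [/\ pp (s n) (a n), ~ pp (s n.+1) (a n) & forall x : M, pp (s n.+1) x -> pp (s n) x].

(** If a finite intersection of subgroups of the family lies in all the others, a point common to
    the corresponding cosets lies in every coset, by finite consistency. Otherwise each finite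
    intersection can be cut down strictly by one more subgroup of the family, and iteration gives a
    descending chain. *)
Lemma no_pp_chain_alg_compact M :
  (~ exists s (a : nat -> M), pp_chain s a) -> alg_compact M.
Proof.
move=> nchain Psi fip.
pose S (l : seq (lsys * M)) (x : M) := forall c, c \in l -> Psi c.1 c.2 -> pp c.1 x.
have [[l lmin]|nmin] := pselect (exists l, forall c x, Psi c.1 c.2 -> S l x -> pp c.1 x).
  have [x xl] := fip l; exists x => s m Pm.
  have [y yl] := fip ((s, m) :: l).
  have -> : x - m = (x - y) + (y - m) by rewrite addrA subrK.
  apply: ppD; last by apply: (yl (s, m)) => //; exact: mem_head.
  apply: (lmin (s, m)) => // c cl Pc; have -> : x - y = (x - c.2) - (y - c.2).
    by rewrite opprB addrA subrK.
  by apply: ppB; [exact: xl|apply: yl => //; rewrite inE cl orbT].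
have step l : exists cx : (lsys * M) * M,
    [/\ Psi cx.1.1 cx.1.2, S l cx.2 & ~ pp cx.1.1 cx.2].
  apply: contrapT => H; apply: nmin; exists l => c x Pc Sx.
  by apply: contrapT => nx; apply: H; exists (c, x).
have {step}[g gP] := choice step.
pose L n := iter n (fun l => (g l).1 :: l) [::].
pose F l := foldr lconj [::] [seq c.1 | c <- l & `[< Psi c.1 c.2 >]].
have FS l x : pp (F l) x <-> S l x.
  rewrite pp_conj_seq; split=> [Fx c cl Pc|Sx s /mapP[c + ->]].
    by apply: Fx; apply/mapP; exists c => //; rewrite mem_filter cl andbT; exact/asboolP.
  by rewrite mem_filter => /andP[/asboolP Pc cl]; exact: Sx.
exfalso; apply: nchain; exists (F \o L), (fun n => (g (L n)).2) => n /=.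
have [Pg Sg ng] := gP (L n); split; first exact/FS.
  by move/FS => Sn; apply: ng; apply: Sn => //; exact: mem_head.
by move=> x /FS Sx; apply/FS => c cl; apply: Sx; rewrite inE cl orbT.
Qed.


(* Zorn's lemma applied to the relations between [N] and [M] along which solutions of finite linear systems can be transported; adding a point [n] to the domain amounts to satisfying a family of cosets of pp-subgroups of [M]. *)
Lemma alg_compact_pure_injective M : alg_compact M -> pure_injective M.
Proof.
move=> acM N f fp; have fl := fp.1.
pose good (G : set (N * M)) := forall (s : lsys) (S : seq nat) (g : nat -> N) (u : nat -> M),
  lsol s g -> (forall k, k \in S -> G (g k, u k)) ->
  exists h : nat -> M, lsol s h /\ forall k, k \in S -> h k = u k.
pose G0 : set (N * M) := [set p | p.1 = f p.2].
have goodG0 : good G0.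
  move=> s S g u gs Sgu; pose E := [seq (t, 0 : M) | t <- s] ++ [seq ([:: (1, k)], u k) | k <- S].
  have [|h hE] := @pure_solve _ _ f E fp.
    exists g => e; rewrite mem_cat => /orP[/mapP[t ts ->]|/mapP[k kS ->]] /=.
      by rewrite gs// is_lin0.
    by have gk : g k = f (u k) := Sgu k kS; rewrite leval1 gk.
  exists h; split=> [t ts|k kS]; first by apply: (hE (t, 0)); rewrite mem_cat map_f.
  have := hE ([:: (1, k)], u k); rewrite leval1 => -> //.
  by rewrite mem_cat (map_f (fun k => ([:: (1, k)], u k))) ?orbT.
have [|G [G0G goodG maxG]] := zorn_above goodG0.
  move=> F F0 FP _ totF s S g u gs Sgu.
  have [X [/FP gX SX]] := chain_seq (x := fun k => (g k, u k)) F0 totF Sgu.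
  exact: gX gs SX.
have total n : exists m, G (n, m).
  (* A pp-condition satisfied by [n] with parameters in the domain of [G]. Variable [0] holds [n]
     and stays out of [S], since its value in [M] is what is sought; [Y] is the set of admissible
     values, a coset of the subgroup given by [homo s S] when it is nonempty. *)
  pose valid s (S : seq nat) (g : nat -> N) (u : nat -> M) :=
    [/\ lsol s g, g 0%N = n, 0%N \notin S & forall k, k \in S -> G (g k, u k)].
  pose Y s (S : seq nat) (u : nat -> M) (y : M) :=
    exists h : nat -> M, [/\ lsol s h, forall k, k \in S -> h k = u k & h 0%N = y].
  pose homo s (S : seq nat) : lsys := s ++ [seq [:: (1, k)] | k <- S].
  have homoP s S (h : nat -> M) : lsol (homo s S) h <->
      lsol s h /\ forall k, k \in S -> h k = 0.
    rewrite lsol_cat; split=> -[h1 h2]; split=> //.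
      by move=> k kS; rewrite -leval1; apply: h2; exact: (map_f (fun k => [:: (1, k)])).
    by move=> _ /mapP[k kS ->]; rewrite leval1 h2.
  pose Psi s' m := exists s S g u, [/\ valid s S g u, s' = homo s S & Y s S u m].
  have PsiP s' m x : Psi s' m -> pp s' (x - m) -> forall s S g u,
      valid s S g u -> s' = homo s S -> Y s S u m -> Y s S u x.
    move=> _ px s S g u _ es [h [hs hS hm]]; move: px; rewrite es -hm => -[k [/homoP[ks kS] kx]].
    exists (fun i => k i - - h i); split=> [||]; last by rewrite kx opprK subrK.
      apply: lsolB => // t ts; rewrite -[RHS](oppr0) -(hs t ts) /leval -sumrN.
      by apply: eq_bigr => p _; rewrite scalerN.
    by move=> i iS; rewrite kS// hS// opprK add0r.
  have [l|y yP] := acM Psi.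
    (* Finitely many conditions on [n] merge into a single one, with variables renamed apart, and
       [goodG] solves that one. *)
    suff [s [S [g [u [v lY]]]]] : exists s S g u, valid s S g u /\
        forall y, Y s S u y -> forall c, c \in l -> Psi c.1 c.2 -> pp c.1 (y - c.2).
      have [gs g0 nS Sgu] := v; have [h [hs hS]] := goodG s S g u gs Sgu.
      by exists (h 0%N); apply: lY; exists h.
    elim: l => [|c l [s [S [g [u [[gs g0 nS Sgu] lY]]]]]].
      by exists [::], [::], (fun=> n), (fun=> 0).
    have [[s' [S' [g' [u' [[gs' g0' nS' Sgu'] cs Yc]]]]]|nc] := pselect (Psi c.1 c.2); last first.
      exists s, S, g, u; split=> // y yY d; rewrite inE => /orP[/eqP->//|]; exact: lY.
    have gg : g 0%N = g' 0%N by rewrite g0 g0'.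
    have uu : forall k, k \in S -> interleave u u' (evens k) = u k.
      by move=> [|k] kS; [rewrite kS in nS|rewrite /= odd_double /= doubleK].
    have uu' : forall k, k \in S' -> interleave u u' (odds k) = u' k.
      by move=> [|k] kS; [rewrite kS in nS'|rewrite /= odd_double /= uphalf_double].
    exists (map (lren evens) s ++ map (lren odds) s'), (map evens S ++ map odds S'),
      (interleave g g'), (interleave u u'); split.
      split=> //.
      - by apply/lsol_cat; split; apply/lsol_ren; rewrite (interleave_evens, interleave_odds).
      - rewrite mem_cat negb_or; apply/andP; split; apply/negP => /mapP[[|k] //].
          by rewrite (negPf nS).
        by rewrite (negPf nS').
      - move=> k; rewrite mem_cat => /orP[/mapP[j jS ->]|/mapP[j jS ->]].
          by rewrite uu// -[interleave g g' _]/((interleave g g' \o evens) j) interleave_evens; exact: Sgu.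
        by rewrite uu'// -[interleave g g' _]/((interleave g g' \o odds) j) interleave_odds//; exact: Sgu'.
    move=> y [h [/lsol_cat[/lsol_ren h1 /lsol_ren h2] hS hy]] d.
    rewrite inE => /orP[/eqP->|dl] Pd; last first.
      apply: lY => //; exists (h \o evens); split=> // k kS.
      by rewrite /= hS ?uu// mem_cat map_f.
    rewrite cs; have [k [ks kS <-]] := Yc.
    exists (fun i => (h \o odds) i - k i); split; last by rewrite /= hy.
    apply/homoP; split; first exact: lsolB.
    by move=> i iS; rewrite /= hS ?uu'// ?kS ?subrr// mem_cat (map_f odds) ?orbT.
  have Yy s S g u : valid s S g u -> Y s S u y.
    move=> v; have [gs g0 nS Sgu] := v; have [h [hs hS]] := goodG s S g u gs Sgu.
    have Yh : Y s S u (h 0%N) by exists h.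
    have Ph : Psi (homo s S) (h 0%N) by exists s, S, g, u.
    exact: (PsiP _ _ _ Ph (yP _ _ Ph) _ _ _ _ v erefl Yh).
  exists y; apply: (maxG (G `|` [set (n, y)])); [by left| |by right].
  move=> s S g u gs Sgu.
  (* All variables carrying the new pair are identified with variable [0]; the others are shifted by
     one. *)
  pose new k := `[< g k = n /\ u k = y >].
  pose r k := if new k then 0%N else k.+1.
  pose g' k := if k is k'.+1 then g k' else n.
  pose u' k := if k is k'.+1 then u k' else 0.
  pose S' := [seq k.+1 | k <- S & ~~ new k].
  have gr : g' \o r = g by apply/funext => k; rewrite /= /r /new; case: asboolP => //= -[-> _].
  have [|h [hs hS hy]] := Yy (map (lren r) s) S' g' u'.
    split=> //; first by apply/lsol_ren; rewrite gr.
      by apply/negP => /mapP[].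
    move=> _ /mapP[k + ->]; rewrite mem_filter => /andP[nk kS] /=.
    by case: (Sgu k kS) => // -[gk uk]; case/negP: nk; exact/asboolP.
  exists (h \o r); split; first exact/lsol_ren.
  move=> k kS; rewrite /= /r; case: ifPn => [/asboolP[_ ->]//|nk].
  by rewrite hS//; apply/mapP; exists k => //; rewrite mem_filter nk.
have [g Gg] := choice total.
(* When [S] contains all variables of [s], the transported solution agrees with [u] on them, so [u]
   itself is a solution. *)
have Gsol s (S : seq nat) (v : nat -> N) (u : nat -> M) : lsol s v ->
    (forall k, k \in S -> G (v k, u k)) -> (forall t p, t \in s -> p \in t -> p.2 \in S) -> lsol s u.
  move=> vs Sv sS t ts; have [h [hs hS]] := goodG s S v u vs Sv.
  rewrite -(hs t ts) /leval big_seq [RHS]big_seq; apply: eq_bigr => p pt.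
  by rewrite hS//; exact: sS ts pt.
(* The system a X_0 + X_1 - X_2 = 0 yields both the linearity of [g] and the fact that [G] is
   single-valued. *)
have GE a x y z u v w : G (x, u) -> G (y, v) -> G (z, w) ->
    a *: x + y = z -> a *: u + v = w.
  move=> Gx Gy Gz e; pose t : lterm := [:: (a, 0%N); (1, 1%N); (- 1, 2%N)].
  pose q (T : lmodType R) (x1 x2 x3 : T) k := nth 0 [:: x1; x2; x3] k.
  have tE (T : lmodType R) (x1 x2 x3 : T) : leval t (q T x1 x2 x3) = a *: x1 + x2 - x3.
    by rewrite /leval !big_cons big_nil /= !scale1r scaleN1r addr0 addrA.
  have := @Gsol [:: t] [:: 0; 1; 2]%N (q N x y z) (q M u v w).
  move=> H; apply/eqP; rewrite -subr_eq0 -tE; apply/eqP/H; last exact: mem_head.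
  - by move=> t'; rewrite inE => /eqP->; rewrite tE e subrr.
  - by move=> k; rewrite !inE => /or3P[] /eqP->.
  - by move=> t' p; rewrite inE => /eqP->; rewrite !inE => /or3P[] /eqP->.
exists g; split=> [a x y|m]; first by apply/esym; exact: GE (Gg _) (Gg _) (Gg _) _.
have G0f m' : G (f m', m') by exact: G0G.
rewrite -[g _]addr0 -(scale1r (g (f m))).
by apply: (GE 1 (f m) 0 (f m)) => //; [rewrite -(is_lin0 fl)|rewrite scale1r addr0].
Qed.

End LinearSystems.

(** * Submodules as modules *)

Section Submodules.
Variables (R : nzRingType) (M : lmodType R).

Record submod := Submod {
  submod_mem :> M -> Prop;
  _ : submod_mem 0;
  _ : forall a x y, submod_mem x -> submod_mem y -> submod_mem (a *: x + y) }.

Definition in_submod (H : submod) : {pred M} := fun x => `[< H x >].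

Lemma submod0 (H : submod) : H 0. Proof. by case: H. Qed.

Lemma submodP (H : submod) a x y : H x -> H y -> H (a *: x + y).
Proof. by case: H x y => H ? HP x y; exact: HP. Qed.

Lemma in_submod_closed H : submod_closed (in_submod H).
Proof.
split; first exact/asboolP/submod0.
by move=> a x y /asboolP Hx /asboolP Hy; exact/asboolP/submodP.
Qed.

HB.instance Definition _ H :=
  GRing.isSubmodClosed.Build R M (in_submod H) (in_submod_closed H).

Record submod_of (H : submod) := SubmodOf { submod_val : M; _ : submod_val \in in_submod H }.

HB.instance Definition _ H := [isSub for @submod_val H].
HB.instance Definition _ H := [Choice of submod_of H by <:].
HB.instance Definition _ H := [SubChoice_isSubLmodule of submod_of H by <:].

Definition submod_incl H : submod_of H -> M := @submod_val H.

Lemma submod_incl_lin H : is_lin (@submod_incl H).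
Proof. by []. Qed.

Lemma submod_incl_inj H : injective (@submod_incl H).
Proof. exact: val_inj. Qed.

Lemma submod_inclP H (x : submod_of H) : H (submod_incl x).
Proof. by apply/asboolP; exact: (valP x). Qed.

Lemma submod_lift (H : submod) x : H x -> exists y : submod_of H, submod_incl y = x.
Proof. by move=> /asboolP Hx; exists (SubmodOf Hx). Qed.

Lemma submod_corestrict (H : submod) (N : lmodType R) (f : N -> M) :
  is_lin f -> (forall x, H (f x)) ->
  exists g : N -> submod_of H, is_lin g /\ forall x, submod_incl (g x) = f x.
Proof.
move=> fl Hf; have /choice[g gP] := fun x => submod_lift (Hf x).
exists g; split=> // a x y; apply: (@submod_incl_inj H).
by rewrite gP fl -!gP.
Qed.

End Submodules.

(** * Characters of abelian groups with values in a divisible group *)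

Section CircleGroup.

(* The multiplicative group of the algebraic numbers, written additively: a divisible abelian group with torsion of every order. *)
Record circle := Circle { circle_val : algC; _ : circle_val != 0 }.
HB.instance Definition _ := [isSub for circle_val].
HB.instance Definition _ := [Choice of circle by <:].

Fact circle_neq0 (x : circle) : val x != 0. Proof. by case: x. Qed.

Definition circle_add (x y : circle) : circle :=
  Circle (mulf_neq0 (circle_neq0 x) (circle_neq0 y)).
Definition circle_zero : circle := Circle (oner_neq0 algC).
Fact circle_inv_neq0 (x : circle) : (val x)^-1 != 0.
Proof. by rewrite invr_eq0; exact: circle_neq0. Qed.
Definition circle_opp (x : circle) : circle := Circle (circle_inv_neq0 x).

Fact circle_addA : associative circle_add.
Proof. by move=> x y z; apply: val_inj; rewrite /= mulrA. Qed.
Fact circle_addC : commutative circle_add.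
Proof. by move=> x y; apply: val_inj; rewrite /= mulrC. Qed.
Fact circle_add0 : left_id circle_zero circle_add.
Proof. by move=> x; apply: val_inj; rewrite /= mul1r. Qed.
Fact circle_addN : left_inverse circle_zero circle_opp circle_add.
Proof. by move=> x; apply: val_inj; rewrite /= mulVf// circle_neq0. Qed.

HB.instance Definition _ :=
  GRing.isZmodule.Build circle circle_addA circle_addC circle_add0 circle_addN.

Lemma circle_valMn (x : circle) n : val (x *+ n) = val x ^+ n.
Proof. by elim: n => [//|n IHn]; rewrite mulrS exprS -IHn. Qed.

Lemma circle_div (t : circle) n : (0 < n)%N -> exists y : circle, y *+ n = t.
Proof.
move=> n0; have y0 : n.-root (val t) != 0 by rewrite rootC_eq0// circle_neq0.
by exists (Circle y0); apply: val_inj; rewrite circle_valMn /= rootCK.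
Qed.

Lemma circle_tors n : (1 < n)%N -> exists z : circle, z != 0 /\ z *+ n = 0.
Proof.
move=> n1; have [z zP] := C_prim_root_exists (ltnW n1).
have z0 : z != 0.
  apply/eqP => z0; have := prim_expr_order zP; rewrite z0 expr0n.
  by case: n n1 {zP} => // n _ /eqP; rewrite eq_sym oner_eq0.
exists (Circle z0); split.
  apply/eqP => /(congr1 val) /= z1; move: zP; rewrite z1 => /prim_order_dvd /(_ 1%N).
  by rewrite expr1 eqxx dvdn1 => /eqP nE; rewrite nE in n1.
by apply: val_inj; rewrite circle_valMn /= (prim_expr_order zP).
Qed.

Lemma circle_nontrivial : exists z : circle, z != 0.
Proof. by have [z [z0 _]] := circle_tors (ltnSn 1); exists z. Qed.

Variable G : zmodType.

(* Graphs of the homomorphisms from a subgroup of [G] to [circle]. *)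
Definition hom_graph (Gm : set (G * circle)) : Prop :=
  [/\ Gm 0, forall p q, Gm p -> Gm q -> Gm (p - q) & forall t, Gm (0, t) -> t = 0].

Lemma hom_graphMz Gm p k : hom_graph Gm -> Gm p -> Gm (p *~ k).
Proof.
move=> [G0 GB _] Gp; have GN q : Gm q -> Gm (- q) by move=> Gq; rewrite -sub0r; exact: GB.
have GD q r : Gm q -> Gm r -> Gm (q + r).
  by move=> Gq Gr; rewrite -[r]opprK; apply: GB => //; exact: GN.
have GMn n : Gm (p *+ n) by elim: n => [//|n IHn]; rewrite mulrS; exact: GD.
by case: k => n; [exact: GMn|rewrite NegzE mulrNz; exact/GN/GMn].
Qed.

Lemma pairMzE (p : G * circle) k : p *~ k = (p.1 *~ k, p.2 *~ k).
Proof. by case: p => u v; case: k => n; rewrite ?NegzE ?mulrNz -?pmulrn pairMnE. Qed.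

(** The new graph is the subgroup generated by [Gm] and [(x, y)]; the condition on multiples of [x]
    is exactly what keeps it single-valued. *)
Lemma hom_graph_extend1 Gm x y : hom_graph Gm ->
  (forall k t, Gm (x *~ k, t) -> t = y *~ k) ->
  exists Gm', [/\ hom_graph Gm', Gm `<=` Gm' & Gm' (x, y)].
Proof.
move=> [G0 GB G1] yP.
exists [set p | exists k, Gm (p - (x, y) *~ k)]; split; first split.
- by exists 0; rewrite mulr0z subr0.
- move=> p q [k Gk] [l Gl]; exists (k - l).
  have -> : p - q - (x, y) *~ (k - l) = p - (x, y) *~ k - (q - (x, y) *~ l).
    by rewrite mulrzBr !opprB addrACA [RHS]addrACA [- q - _]addrC.
  exact: GB.
- move=> t [k]; have -> : (0, t) - (x, y) *~ k = (x *~ (- k), t - y *~ k).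
    by rewrite pairMzE /= mulrNz; congr (_, _); rewrite /= sub0r.
  by move=> /yP; rewrite mulrNz => /eqP; rewrite subr_eq addNr => /eqP.
- by move=> p Gp; exists 0; rewrite mulr0z subr0.
by exists 1; rewrite mulr1z subrr.
Qed.

(** If [n] is the least positive integer with n x in the domain, [y] has to be an n-th part of the
    value there; should it vanish, an n-torsion element is added, which exists because n > 1. If
    there is no such [n], any nonzero [y] will do. That [y] is nonzero is what lets characters
    separate points. *)
Lemma hom_graph_value Gm x : hom_graph Gm -> ~ (exists t, Gm (x, t)) ->
  exists y, y != 0 /\ forall k t, Gm (x *~ k, t) -> t = y *~ k.
Proof.
move=> gG ndom; have [G0 GB G1] := gG.
have [[n0 n0P]|nt] := pselect (exists n, (0 < n)%N && `[< exists t, Gm (x *+ n, t) >]); last first.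
  have [y y0] := circle_nontrivial; exists y; split=> // k t Gt.
  have [k0|k0] := eqVneq k 0.
    by move: Gt; rewrite k0 !mulr0z => /G1.
  exfalso; apply: nt; exists `|k|%N; rewrite absz_gt0 k0; apply/asboolP.
  have := hom_graphMz (sgz k) gG Gt; rewrite pairMzE /= -mulrzA mulrC -abszEsg => Gk.
  by exists (t *~ sgz k); rewrite pmulrn.
have exn : exists n, (0 < n)%N && `[< exists t, Gm (x *+ n, t) >] by exists n0.
case: (ex_minnP exn) => n /andP[n_gt0 /asboolP[t0 Gt0]] nmin.
have n_gt1 : (1 < n)%N.
  rewrite ltn_neqAle n_gt0 andbT; apply/eqP => n1.
  by apply: ndom; exists t0; move: Gt0; rewrite -n1.
have [y yn] := circle_div t0 n_gt0; have [z [z0 zn]] := circle_tors n_gt1.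
have [y' [y'0 y'n]] : exists y', y' != 0 /\ y' *+ n = t0.
  have [y0|] := eqVneq y 0; last by exists y.
  by exists (y + z); rewrite mulrnDl yn zn addr0 y0 add0r.
exists y'; split=> // k t Gt.
have [q [r [kE r_ge0 r_ltn]]] : exists q r : int, [/\ k = q * n + r, 0 <= r & r < n].
  exists (k %/ n)%Z, (k %% n)%Z; split; first exact: divz_eq.
    by apply: modz_ge0; rewrite eqz_nat -lt0n.
  exact: ltz_pmod.
have Gr : Gm (x *~ r, t - t0 *~ q).
  have -> : (x *~ r, t - t0 *~ q) = (x *~ k, t) - (x *+ n, t0) *~ q.
    rewrite pairMzE /=; congr (_, _); rewrite /= {1}kE mulrzDr [q * _]mulrC mulrzA -pmulrn.
    by rewrite addrAC subrr add0r.
  by apply: GB => //; exact: hom_graphMz.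
have r0 : r = 0.
  apply/eqP; apply: contraT => r_neq0.
  have r_lt : (`|r| < n)%N by rewrite -ltz_nat gez0_abs.
  have : (n <= `|r|)%N.
    apply: nmin; rewrite absz_gt0 r_neq0; apply/asboolP; exists (t - t0 *~ q).
    by rewrite pmulrn gez0_abs.
  by rewrite leqNgt r_lt.
move: Gr; rewrite r0 mulr0z => /G1 /eqP; rewrite subr_eq0 => /eqP ->.
by rewrite {1}kE r0 addr0 mulrC mulrzA -y'n pmulrn.
Qed.

Lemma hom_graph_total Gm : hom_graph Gm ->
  exists chi : G -> circle, {morph chi : x y / x - y} /\ forall x t, Gm (x, t) -> chi x = t.
Proof.
move=> gG.
have [|A [GA gA maxA]] := zorn_above gG.
  move=> F [X0 FX0] FP _ totF; split.
  - by exists X0 => //; have [] := FP _ FX0.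
  - move=> p q Fp Fq; have [X [FX Xp Xq]] := chain_pair totF Fp Fq.
    by exists X => //; have [_ XB _] := FP _ FX; exact: XB.
  - by move=> t [X FX Xt]; have [_ _ X1] := FP _ FX; exact: X1.
have [A0 AB A1] := gA.
have dom x : exists t, A (x, t).
  apply: contrapT => nx; have [y [_ yP]] := hom_graph_value gA nx.
  have [B [gB AB' Bxy]] := hom_graph_extend1 gA yP.
  by apply: nx; exists y; exact: maxA Bxy.
have uniq x t u : A (x, t) -> A (x, u) -> t = u.
  move=> At Au; have := AB _ _ At Au.
  have -> : (x, t) - (x, u) = (0, t - u) by congr (_, _); exact: subrr.
  move=> /A1/eqP.
  by rewrite subr_eq0 => /eqP.
have [chi chiA] := choice dom; exists chi; split=> [x y|x t /GA At].
  by apply: uniq (chiA _) _; exact: AB (chiA x) (chiA y).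
exact: uniq (chiA _) At.
Qed.

Lemma circle_separates (H : set G) b : H 0 -> (forall x y, H x -> H y -> H (x - y)) -> ~ H b ->
  exists chi : G -> circle,
    [/\ {morph chi : x y / x - y}, forall x, H x -> chi x = 0 & chi b != 0].
Proof.
move=> H0 HB nb; pose Gm : set (G * circle) := [set p | H p.1 /\ p.2 = 0].
have gG : hom_graph Gm.
  split=> [|p q [Hp p0] [Hq q0]|t []] //.
  by split; [exact: HB|rewrite /= p0 q0 subrr].
have [|y [y0 yP]] := hom_graph_value (x := b) gG; first by case=> t [].
have [B [gB GB Bb]] := hom_graph_extend1 gG yP.
have [chi [chiM chiB]] := hom_graph_total gB.
exists chi; split=> [//|x Hx|]; first by apply: chiB; exact: GB.
by rewrite (chiB _ _ Bb).
Qed.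

End CircleGroup.

(** Functions eventually constant along the directed set of finite lists form a subgroup on which
    the limit is a homomorphism; divisibility of [circle] extends it to all functions, so no
    ultrafilter is involved. *)
Lemma circle_limit (C : eqType) : exists rho : (seq C -> circle) -> circle,
  {morph rho : x y / x - y} /\
  forall (h : seq C -> circle) t (l0 : seq C),
    (forall l : seq C, {subset l0 <= l} -> h l = t) -> rho h = t.
Proof.
pose Gm : set ((seq C -> circle) * circle) :=
  [set p | exists l0 : seq C, forall l : seq C, {subset l0 <= l} -> p.1 l = p.2].
have gG : hom_graph Gm.
  split=> [|p q [l1 lp] [l2 lq]|t [l0 lt]]; first by exists [::].
    exists (l1 ++ l2) => l sl; rewrite -[(p - q).1 l]/(p.1 l - q.1 l).
    by rewrite lp ?lq// => x xl; apply: sl; rewrite mem_cat xl ?orbT.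
  by apply/esym; exact: (lt l0).
have [rho [rhoM rhoG]] := hom_graph_total gG.
by exists rho; split=> // h t l0 hl; apply: rhoG; exists l0.
Qed.

(** * The character bidual *)

Lemma subrACA (V : zmodType) (a b c d : V) : a - b - (c - d) = a - c - (b - d).
Proof. by rewrite !opprB addrACA [RHS]addrACA [- b - c]addrC. Qed.

Section Bidual.
Variables (R : nzRingType) (M : lmodType R).

Definition is_char (chi : M -> circle) : Prop := {morph chi : x y / x - y}.

(* An additive map on the group of characters of [M] is represented by its extension by [0] to all the functions [M -> circle]. *)
Definition bidual_pred : {pred (M -> circle) -> circle} := fun F =>
  `[< (forall chi psi, is_char chi -> is_char psi -> F (chi - psi) = F chi - F psi) /\
      (forall chi, ~ is_char chi -> F chi = 0) >].

Fact bidual_closed : zmod_closed bidual_pred.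
Proof.
split=> [|F G /asboolP[FB F0] /asboolP[GB G0]]; apply/asboolP.
  by split=> // chi psi _ _; rewrite subrr.
split=> [chi psi cchi cpsi|chi nchi]; rewrite -![(F - G) _]/(F _ - G _).
  by rewrite FB// GB// subrACA.
by rewrite F0// G0// subrr.
Qed.

HB.instance Definition _ :=
  GRing.isZmodClosed.Build ((M -> circle) -> circle) bidual_pred bidual_closed.

Record bidual := Bidual { bidual_val : (M -> circle) -> circle; _ : bidual_val \in bidual_pred }.
HB.instance Definition _ := [isSub for bidual_val].
HB.instance Definition _ := [Choice of bidual by <:].
HB.instance Definition _ := [SubChoice_isSubZmodule of bidual by <:].

Lemma bidualB (F : bidual) chi psi : is_char chi -> is_char psi ->
  val F (chi - psi) = val F chi - val F psi.
Proof. by have /asboolP[FB _] := valP F => cchi cpsi; exact: FB. Qed.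

Lemma bidual_out (F : bidual) chi : ~ is_char chi -> val F chi = 0.
Proof. by have /asboolP[_ F0] := valP F; exact: F0. Qed.

Lemma is_charB chi psi : is_char chi -> is_char psi -> is_char (chi - psi).
Proof.
move=> cchi cpsi x y; rewrite -![(chi - psi) _]/(chi _ - psi _) cchi cpsi.
by rewrite subrACA.
Qed.

Lemma is_char0 chi : is_char chi -> chi 0 = 0.
Proof. by move=> /(_ 0 0); rewrite !subrr. Qed.

Lemma is_charN chi x : is_char chi -> chi (- x) = - chi x.
Proof. by move=> c; rewrite -sub0r c is_char0// sub0r. Qed.

Lemma is_charD chi x y : is_char chi -> chi (x + y) = chi x + chi y.
Proof. by move=> c; rewrite -{1}[y]opprK c is_charN// opprK. Qed.

Lemma is_charN_fun chi : is_char chi -> is_char (- chi).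
Proof.
by move=> c x y; rewrite -![(- chi) _]/(- chi _) c opprB opprK addrC.
Qed.

Lemma is_char_zero : is_char 0.
Proof. by move=> x y; rewrite -![(0 : M -> circle) _]/(0 : circle) subrr. Qed.

Lemma bidual0 (F : bidual) : val F 0 = 0.
Proof.
by have := bidualB F is_char_zero is_char_zero; rewrite !subrr.
Qed.

Lemma bidualD (F : bidual) chi psi : is_char chi -> is_char psi ->
  val F (chi + psi) = val F chi + val F psi.
Proof.
move=> cchi cpsi; have cN := is_charN_fun cpsi.
rewrite -{1}[psi]opprK bidualB//; congr (_ + _).
by rewrite -[- psi]sub0r bidualB ?bidual0 ?sub0r ?opprK//; exact: is_char_zero.
Qed.

Lemma is_char_scale chi (a : R) : is_char chi -> is_char (fun x => chi (a *: x)).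
Proof. by move=> c x y; rewrite scalerBr c. Qed.

(** Characters form a right module, [a] taking chi to chi(a _), so functionals on them form a left
    module again. The value [0] off the characters keeps the result in [bidual_pred]. *)
Definition bidual_scale_fun (a : R) (F : (M -> circle) -> circle) chi : circle :=
  if `[< is_char chi >] then F (fun x => chi (a *: x)) else 0.

Fact bidual_scale_subproof a (F : bidual) : bidual_scale_fun a (val F) \in bidual_pred.
Proof.
apply/asboolP; rewrite /bidual_scale_fun; split=> [chi psi cc cp|chi nc]; last by case: asboolP.
rewrite !asboolT//; last exact: is_charB.
by rewrite -bidualB//; exact: is_char_scale.
Qed.

Definition bidual_scale a F : bidual := Bidual (bidual_scale_subproof a F).

Lemma bidual_scaleE a F chi : is_char chi ->
  val (bidual_scale a F) chi = val F (fun x => chi (a *: x)).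
Proof. by move=> c; rewrite /= /bidual_scale_fun asboolT. Qed.

Lemma bidual_eq (F G : bidual) : (forall chi, is_char chi -> val F chi = val G chi) -> F = G.
Proof.
move=> FG; apply/val_inj/funext => chi; have [c|nc] := pselect (is_char chi); first exact: FG.
by rewrite !bidual_out.
Qed.

Fact bidual_scaleA a b F : bidual_scale a (bidual_scale b F) = bidual_scale (a * b) F.
Proof.
apply: bidual_eq => chi c; rewrite !bidual_scaleE//; last exact: is_char_scale.
by congr (val F _); apply/funext => x; rewrite scalerA.
Qed.
Fact bidual_scale1 : left_id 1 bidual_scale.
Proof.
move=> F; apply: bidual_eq => chi c; rewrite !bidual_scaleE//.
by congr (val F _); apply/funext => x; rewrite scale1r.
Qed.
Fact bidual_scaleDr : right_distributive bidual_scale +%R.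
Proof.
move=> a F G; apply: bidual_eq => chi c.
by rewrite bidual_scaleE// -![val (_ + _) _]/(val _ _ + val _ _) !bidual_scaleE.
Qed.
Fact bidual_scaleDl F : {morph bidual_scale^~ F : a b / a + b}.
Proof.
move=> a b; apply: bidual_eq => chi c.
rewrite bidual_scaleE// -[RHS]/(val _ _ + val _ _) !bidual_scaleE//.
rewrite -bidualD; [|exact: is_char_scale|exact: is_char_scale].
by congr (val F _); apply/funext => x; rewrite scalerDl is_charD.
Qed.

HB.instance Definition _ := GRing.Zmodule_isLmodule.Build R bidual
  bidual_scaleA bidual_scale1 bidual_scaleDr bidual_scaleDl.

Fact bidual_ev_subproof (x : M) :
  (fun chi : M -> circle => if `[< is_char chi >] then chi x else 0) \in bidual_pred.
Proof.
apply/asboolP; split=> [chi psi cc cp|chi nc]; last by case: asboolP.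
by rewrite !asboolT//; exact: is_charB.
Qed.

Definition bidual_ev x : bidual := Bidual (bidual_ev_subproof x).

Lemma bidual_evE x chi : is_char chi -> val (bidual_ev x) chi = chi x.
Proof. by move=> c; rewrite /= asboolT. Qed.

Lemma bidual_ev_lin : is_lin bidual_ev.
Proof.
move=> a x y; apply: bidual_eq => chi c.
rewrite -[RHS]/(val (bidual_scale _ _) _ + val _ _) bidual_scaleE// !bidual_evE//.
  by rewrite is_charD.
exact: is_char_scale.
Qed.

Lemma bidual_sum (I : Type) (s : seq I) (F : I -> bidual) chi :
  val (\sum_(i <- s) F i) chi = \sum_(i <- s) val (F i) chi.
Proof. by elim/big_rec2: _ => // i y1 y2 _ <-. Qed.

Lemma is_charD_fun chi psi : is_char chi -> is_char psi -> is_char (chi + psi).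
Proof. by move=> c c'; rewrite -[psi]opprK; apply: is_charB => //; exact: is_charN_fun. Qed.

Lemma bidual_sum_char (I : Type) (s : seq I) (F : bidual) (chi : I -> M -> circle) :
  (forall i, is_char (chi i)) -> val F (\sum_(i <- s) chi i) = \sum_(i <- s) val F (chi i).
Proof.
move=> c; suff [] : is_char (\sum_(i <- s) chi i) /\
    val F (\sum_(i <- s) chi i) = \sum_(i <- s) val F (chi i) by [].
elim: s => [|i s [cs IHs]]; first by rewrite !big_nil bidual0; split=> //; exact: is_char_zero.
by rewrite !big_cons bidualD// IHs; split=> //; exact: is_charD_fun.
Qed.

(* A character of [M ^ m] killing the image of [A] but not [b] obstructs the solvability of [A x = b] in the bidual. *)
Lemma bidual_ev_pure : pure_emb bidual_ev.
Proof.
have solve m n (A : 'M[R]_(m, n)) (b : 'I_m -> M) :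
    (exists x : 'I_n -> bidual, forall i, \sum_(j < n) A i j *: x j = bidual_ev (b i)) ->
    exists y : 'I_n -> M, forall i, \sum_(j < n) A i j *: y j = b i.
  move=> [x Ax]; apply: contrapT => nsol.
  pose H : set ('I_m -> M) := [set c | exists y : 'I_n -> M, forall i, \sum_(j < n) A i j *: y j = c i].
  have [|c d [y yc] [z zd]|//|chi [chiB chiH]] := @circle_separates _ H b.
  - exists (fun=> 0) => i; rewrite big1// => j _; by rewrite scaler0.
  - exists (fun j => y j - z j) => i; rewrite -[RHS]/(c i - d i) -yc -zd -sumrB.
    by apply: eq_bigr => j _; rewrite scalerBr.
  pose at_ i (v : M) : 'I_m -> M := fun k => if k == i then v else 0.
  pose ch i v := chi (at_ i v).
  have chiD c d : chi (c + d) = chi c + chi d.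
    have chi0 : chi 0 = 0 by rewrite -(subrr 0) chiB subrr.
    have chiN e : chi (- e) = - chi e by rewrite -sub0r chiB chi0 sub0r.
    by rewrite -{1}[d]opprK chiB chiN opprK.
  have chi0 : chi 0 = 0 by rewrite -(subrr 0) chiB subrr.
  have cch i : is_char (ch i).
    move=> u v; rewrite /ch -chiB; congr chi; apply/funext => k.
    by rewrite /at_ -[RHS]/(at_ i u k - at_ i v k) /at_; case: eqP; rewrite ?subrr.
  have chiE c : chi c = \sum_i ch i (c i).
    rewrite /ch -(big_morph chi chiD chi0); congr chi; apply/funext => k.
    rewrite fct_sumE (bigD1 k)//= /at_ eqxx big1 ?addr0// => i.
    by rewrite eq_sym; case: eqP.
  (* The entries [A i j *: v] form the image under [A] of the vector with [v] in place [j], so [chi]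
     kills them. *)
  have rel j v : \sum_i ch i (A i j *: v) = 0.
    rewrite -(chiE (fun i => A i j *: v)); apply: chiH.
    exists (fun k => if k == j then v else 0) => i.
    rewrite (bigD1 j)//= eqxx big1 ?addr0// => k; case: eqP => // _ _; exact: scaler0.
  apply/negP; rewrite negbK chiE; apply/eqP.
  (* Writing [bidual_ev (b i)] as the sum of the [A i j *: x j] and exchanging the sums evaluates
     each [x j] at a sum of characters that [rel] shows to be zero; hence chi(b) = 0, against the
     choice of chi. *)
  under eq_bigr => i _ do rewrite -(bidual_evE _ (cch i)) -Ax bidual_sum.
  rewrite exchange_big big1// => j _.
  have sE i : val (A i j *: x j) (ch i) = val (x j) (fun v => ch i (A i j *: v)).
    exact: bidual_scaleE.
  under eq_bigr => i _ do rewrite sE.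
  have cA i : is_char (fun v => ch i (A i j *: v)) by exact: is_char_scale.
  rewrite -bidual_sum_char// -[RHS](bidual0 (x j)); congr (val (x j)).
  by apply/funext => v; rewrite fct_sumE rel.
split; first exact: bidual_ev_lin.
split; last exact: solve.
apply: (is_lin_inj bidual_ev_lin) => x x0; apply: contrapT => nx.
have [|||chi [cchi _]] := @circle_separates _ [set 0] x.
- by [].
- by move=> _ _ -> ->; rewrite subrr.
- by [].
by rewrite -bidual_evE// x0 eqxx.
Qed.

(* [circle_limit] provides a linear retraction of the reduced powers of the bidual. *)
Lemma bidual_limit (C : eqType) : exists lim : (seq C -> bidual) -> bidual, is_lin lim /\
  forall (h : seq C -> bidual) m (l0 : seq C),
    (forall l : seq C, {subset l0 <= l} -> h l = m) -> lim h = m.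
Proof.
have [rho [rhoM rhoE]] := circle_limit C.
have rho0 : rho 0 = 0 by rewrite -(subrr 0) rhoM subrr.
have rhoN h : rho (- h) = - rho h by rewrite -sub0r rhoM rho0 sub0r.
have rhoD h k : rho (h + k) = rho h + rho k.
  by rewrite -{1}[k]opprK rhoM rhoN opprK.
have limP (h : seq C -> bidual) : (fun chi => rho (fun l => val (h l) chi)) \in bidual_pred.
  apply/asboolP; split=> [chi psi cc cp|chi nc].
    by rewrite -rhoM; congr rho; apply/funext => l; rewrite bidualB.
  by rewrite -[RHS]rho0; congr rho; apply/funext => l; rewrite bidual_out.
exists (fun h => Bidual (limP h)); split=> [a h k|h m l0 hl].
  apply: bidual_eq => chi c; rewrite -[RHS]/(val (bidual_scale _ _) _ + val _ _) bidual_scaleE//=.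
  rewrite -rhoD; congr rho; apply/funext => l.
  by rewrite -[LHS]/(val (bidual_scale _ _) _ + val _ _) bidual_scaleE.
by apply: bidual_eq => chi c /=; apply: (rhoE _ _ l0) => l /hl ->.
Qed.

(** Each finite subfamily [l] has a common point [x l]. For a fixed coset [c], witnesses exist at
    every [l] containing [c], and the linear map [lim] turns them into a witness for [lim x]. *)
Lemma bidual_alg_compact : alg_compact bidual.
Proof.
move=> Psi fip; have [x xP] := choice fip.
have [lim [limL limE]] := bidual_limit ((lsys R * bidual)%type : eqType).
have h lc : exists w : nat -> bidual, lc.2 \in lc.1 -> Psi lc.2.1 lc.2.2 ->
    lsol lc.2.1 w /\ w 0%N = x lc.1 - lc.2.2.
  have [[cl Pc]|nP] := pselect (lc.2 \in lc.1 /\ Psi lc.2.1 lc.2.2).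
    by have [w wP] := xP _ _ cl Pc; exists w.
  by exists (fun=> 0) => cl Pc; case: nP.
have {h}[w wP] := choice h.
exists (lim x) => s m Pm; pose c : lsys R * bidual := (s, m).
have lc (l : seq (lsys R * bidual)) : {subset [:: c] <= l} -> c \in l.
  by apply; exact: mem_head.
pose RP : lmodType R := (seq (lsys R * bidual) -> bidual : Type).
pose W k : RP := fun l => w (l, c) k.
exists (fun k => lim (W k)); split.
  move=> t ts; rewrite -[LHS](@leval_lin _ RP _ lim t W limL).
  apply: (limE _ _ [:: c]) => l /lc cl.
  rewrite (@leval_lin _ RP _ (fun h : RP => h l))//.
  by have [/= ws _] := wP (l, c) cl Pm; exact: ws.
have limc : lim (fun=> m) = m by exact: (limE _ _ [::]).
have limB (h k : RP) : lim (h - k) = lim h - lim k by exact: is_linB.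
rewrite -[X in _ - X]limc -limB; apply/eqP; rewrite -subr_eq0 -limB; apply/eqP.
apply: (limE _ _ [:: c]) => l /lc cl; have [/= _ w0] := wP (l, c) cl Pm.
by rewrite -[LHS]/(w (l, c) 0%N - (x l - m)) w0 subrr.
Qed.
End Bidual.

(** * Small pure submodules of algebraically compact modules *)

Section PPClosed.
Variables (R : nzRingType) (M : lmodType R).

(** A single closure condition, with the first [p] variables as parameters, gives both the submodule
    axioms and purity, because the module operations are solutions of linear systems. *)
Definition pp_closed (B : set M) : Prop := forall (s : lsys R) p (u : nat -> M),
  (forall k, (k < p)%N -> B (u k)) ->
  (exists h : nat -> M, lsol s h /\ forall k, (k < p)%N -> h k = u k) ->
  exists h : nat -> M, [/\ forall k, B (h k), lsol s h & forall k, (k < p)%N -> h k = u k].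

Lemma pp_closed0 B : pp_closed B -> B 0.
Proof.
move=> cB; have [//||h [Bh hs _]] := cB [:: [:: (1, 0%N)]] 0%N (fun=> 0).
  by exists (fun=> 0); split=> // t; rewrite inE => /eqP->; rewrite leval1.
by have <- : h 0%N = 0 by rewrite -leval1; exact/hs/mem_head.
Qed.

Lemma pp_closedP B a x y : pp_closed B -> B x -> B y -> B (a *: x + y).
Proof.
move=> cB Bx By; pose t : lterm R := [:: (a, 0%N); (1, 1%N); (- 1, 2%N)].
have tE (h : nat -> M) : leval t h = a *: h 0%N + h 1%N - h 2%N.
  by rewrite /leval !big_cons big_nil /= scale1r scaleN1r addr0 addrA.
have [||h [Bh hs hu]] := cB [:: t] 2%N (nth 0 [:: x; y]).
- by move=> [|[|]].
- exists (nth 0 [:: x; y; a *: x + y]); split; last by move=> [|[|]].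
  by move=> u; rewrite inE => /eqP->; rewrite tE subrr.
have := hs t (mem_head _ _); rewrite tE (hu 0%N)// (hu 1%N)//= => /eqP; rewrite subr_eq0 => /eqP ->.
exact: Bh.
Qed.

Definition pp_submod B (cB : pp_closed B) : submod M :=
  Submod (pp_closed0 cB) (fun a x y => @pp_closedP B a x y cB).

Lemma pp_submod_pure B (cB : pp_closed B) : pure_emb (@submod_incl R M (pp_submod cB)).
Proof.
apply: pure_of_solve; [exact: submod_incl_lin|exact: submod_incl_inj|].
move=> E [h hE]; pose n := size E; pose e0 : lterm R * submod_of (pp_submod cB) := ([::], 0).
pose b i := submod_incl (nth e0 E i).2.
(* [pp_closed] speaks of homogeneous systems, so the right-hand sides become the parameters [0],
   ..., [n - 1] and the unknowns are shifted by [n]. *)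
pose s : lsys R := [seq (-1, i) :: lren (addn n) (nth e0 E i).1 | i <- iota 0 n].
have sE (k : nat -> M) : lsol s k <-> forall i, (i < n)%N ->
    leval (nth e0 E i).1 (k \o addn n) = k i.
  have e i : leval ((-1, i) :: lren (addn n) (nth e0 E i).1) k =
      leval (nth e0 E i).1 (k \o addn n) - k i.
    by rewrite -leval_ren /leval big_cons /= scaleN1r addrC.
  split=> [ks i ilt|ks _ /mapP[i + ->]].
    by apply/eqP; rewrite -subr_eq0 -e; apply/eqP/ks/map_f; rewrite mem_iota.
  by rewrite mem_iota add0n => ilt; rewrite e ks// subrr.
have [||k [Bk /sE ks kb]] := cB s n b.
- by move=> i _; exact: (submod_inclP (nth e0 E i).2).
- exists (fun i => if (i < n)%N then b i else h (i - n)%N); split; last by move=> i ->.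
  apply/sE => i ilt; rewrite ilt /b -hE ?mem_nth//; congr leval.
  by apply/funext => j /=; rewrite ltnNge leq_addr /= addKn.
have /choice[g gP] : forall i, exists y : submod_of (pp_submod cB), submod_incl y = k (n + i)%N.
  by move=> i; apply: submod_lift; exact: Bk.
exists g => e eE; apply: (@submod_incl_inj _ _ (pp_submod cB)).
rewrite leval_lin; last exact: submod_incl_lin.
have -> : @submod_incl _ _ (pp_submod cB) \o g = k \o addn n by apply/funext.
by have := ks (index e E); rewrite index_mem nth_index// => -> //; rewrite kb ?index_mem// /b nth_index.
Qed.

(* A consistent family of cosets involves each pp-subgroup at most once, so that only families indexed by pp-formulas have to be considered. *)
Lemma pp_submod_alg_compact B (cB : pp_closed B) : alg_compact M ->
  (forall (D : set (lsys R)) (m : lsys R -> M), (forall s, B (m s)) ->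
    (exists x, forall s, D s -> pp s (x - m s)) ->
    exists x, B x /\ forall s, D s -> pp s (x - m s)) ->
  alg_compact (submod_of (pp_submod cB)).
Proof.
move=> acM meetB Psi fip; pose i := @submod_incl _ _ (pp_submod cB).
have il : is_lin i by exact: submod_incl_lin.
have ip : pure_emb i by exact: pp_submod_pure.
pose PsiM s m := exists m', i m' = m /\ Psi s m'.
have [|x xP] := acM PsiM.
  move=> l; pose lift m : submod_of (pp_submod cB) :=
    if pselect (exists m', i m' = m) is left e then projT1 (cid e) else 0.
  have [x xl] := fip [seq (c.1, lift c.2) | c <- l].
  exists (i x) => -[s m] cl [m' /= [im' Pm']]; rewrite -im' -is_linB//; apply: pp_lin => //.
  suff lm : lift m = m'.
    by have := xl _ (map_f (fun c => (c.1, lift c.2)) cl); rewrite /= lm; exact.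
  rewrite /lift; case: pselect => [e|[]]; last by exists m'.
  by apply: (@submod_incl_inj _ _ (pp_submod cB)); rewrite -/i (projT2 (cid e)).
have /choice[m mP] : forall s, exists m, (exists m', Psi s m') -> Psi s m.
  by move=> s; have [[m Pm]|nP] := pselect (exists m', Psi s m'); [exists m|exists 0].
have [||y [By yP]] := meetB [set s | exists m', Psi s m'] (i \o m).
- by move=> s; exact: (submod_inclP (m s)).
- by exists x => s Ps; apply: xP; exists (m s); split=> //; exact: mP.
have [y' y'E] := @submod_lift _ _ (pp_submod cB) y By.
exists y' => s m' Pm'; have Ps : exists m', Psi s m' by exists m'.
have -> : y' - m' = (y' - m s) + (m s - m') by rewrite addrA subrK.
apply: ppD.
  by apply: (pp_pure ip); rewrite is_linB// [i y']y'E; exact: yP.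
have [z zP] := fip [:: (s, m s); (s, m')].
have -> : m s - m' = (z - m') - (z - m s) by rewrite opprB [RHS]addrC addrA subrK.
apply: ppB; first by apply: (zP (s, m')); rewrite ?inE ?eqxx ?orbT.
by apply: (zP (s, m s)); rewrite ?inE ?eqxx//; exact: mP.
Qed.

End PPClosed.

Section Hull.
Variable R : nzRingType.

(** Names for the elements generated from a sequence by chosen solutions ([PSolve]) and chosen
    common points of cosets ([PMeet]). Indexing the cosets by pp-formulas makes this type, and so
    the bound on the size of a hull, depend on [R] only. *)
Inductive pp_term : Type :=
| PVar of nat
| PSolve of lsys R & nat & nat & (nat -> pp_term)
| PMeet of set (lsys R) & (lsys R -> pp_term).

Variables (M : lmodType R) (t : nat -> M).

Definition pp_solution (s : lsys R) p (u : nat -> M) : nat -> M :=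
  if pselect (exists h : nat -> M, lsol s h /\ forall k, (k < p)%N -> h k = u k)
  is left e then projT1 (cid e) else (fun=> 0).

Definition pp_meet (D : set (lsys R)) (m : lsys R -> M) : M :=
  if pselect (exists x, forall s, D s -> pp s (x - m s)) is left e
  then projT1 (cid e) else 0.

Fixpoint pp_eval (w : pp_term) : M :=
  match w with
  | PVar k => t k
  | PSolve s p j u => pp_solution s p (fun k => pp_eval (u k)) j
  | PMeet D m => pp_meet D (fun s => pp_eval (m s))
  end.

Definition hull : set M := [set x | exists w, pp_eval w = x].

Lemma hull_var k : hull (t k). Proof. by exists (PVar k). Qed.

Lemma hull_closed : pp_closed hull.
Proof.
move=> s p u Bu [h [hs hu]].
have /choice[w wP] : forall k, exists w, (k < p)%N -> pp_eval w = u k.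
  move=> k; have [kp|_] := boolP (k < p)%N; last by exists (PVar 0).
  by have [w <-] := Bu k kp; exists w.
exists (fun j => pp_eval (PSolve s p j w)); rewrite /= /pp_solution.
case: pselect => [e|[]]; last by exists h; split=> // k kp; rewrite wP// hu.
have [e1 e2] := projT2 (cid e); split=> [k||k kp] //; last by rewrite e2// wP.
by exists (PSolve s p k w); rewrite /= /pp_solution; case: pselect => // e'; rewrite (Prop_irrelevance e' e).
Qed.

Lemma hull_meet (D : set (lsys R)) (m : lsys R -> M) : (forall s, hull (m s)) ->
  (exists x, forall s, D s -> pp s (x - m s)) ->
  exists x, hull x /\ forall s, D s -> pp s (x - m s).
Proof.
move=> Bm [x xP]; have /choice[w wP] := Bm.
exists (pp_eval (PMeet D w)); split; first by exists (PMeet D w).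
have -> : m = (fun s => pp_eval (w s)) by apply/funext.
rewrite /= /pp_meet; case: pselect => [e|[]]; first exact: projT2 (cid e).
by exists x => s Ds; rewrite wP; exact: xP.
Qed.

End Hull.

(* Each finite tuple of [N] lies in the hull of a sequence, which is contained in [N]. *)
Lemma lpi_pure_submodule (R : nzRingType) (H : lmodType R) (L A : Type) (i : A -> H) (a0 : A) :
  alg_compact H -> card_le nat L -> card_le (pp_term R) L -> card_le A L ->
  exists (N : lmodType R) (f : N -> H), [/\ pure_emb f, locally_pure_injective N,
    card_le N L & forall a, exists y, f y = i a].
Proof.
move=> acH Linf leT leA.
have [dA dAP] := cardle_decode a0 leA.
have [dT dTP] : exists f : L -> seq L * pp_term R, forall x, exists b, f b = x.
  apply: cardle_decode; first exact: ([::], PVar R 0).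
  exact: cardle_trans (cardle_prod (cardle_seq Linf) leT) (cardle_square Linf).
(* A label of the next stage codes a finite list of labels of the current stage and a term to be
   evaluated at the points they name, padded by [0]. *)
pose step (e : L -> H) l := pp_eval (nth 0 (map e (dT l).1)) (dT l).2.
pose e n := iter n step (i \o dA).
pose B : set H := [set x | exists n l, e n l = x].
(* The stages increase, because the term [PVar 0] reproduces a point. *)
have eS n x : (exists l, e n l = x) -> exists l, e n.+1 l = x.
  by move=> [l <-]; have [l' lE] := dTP ([:: l], PVar R 0); exists l'; rewrite /= /step lE.
have eD n m x : (exists l, e n l = x) -> exists l, e (n + m)%N l = x.
  by elim: m => [|m IHm] ex; rewrite ?addn0 // addnS; exact/eS/IHm.
(* A finite tuple already lies in one stage, hence its hull lies in the next one. *)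
have finB (u : nat -> H) p : (forall k, (k < p)%N -> B (u k)) ->
    exists t, (forall k, (k < p)%N -> t k = u k) /\ hull t `<=` B.
  move=> Bu; have [n nP] : exists n, forall k, (k < p)%N -> exists l, e n l = u k.
    elim: p Bu => [|p IHp] Bu; first by exists 0%N.
    have [|n nP] := IHp; first by move=> k kp; apply: Bu; exact: ltnW.
    have [m [l ml]] := Bu p (ltnSn p); exists (n + m)%N => k.
    rewrite ltnS leq_eqVlt => /orP[/eqP->|/nP]; last exact: eD.
    by rewrite addnC; apply: eD; exists l.
  have [l0 _] := dTP ([::], PVar R 0).
  have /choice[l lP] : forall k, exists l, (k < p)%N -> e n l = u k.
    move=> k; have [kp|_] := boolP (k < p)%N; last by exists l0.
    by have [l lP] := nP k kp; exists l.
  exists (nth 0 (map (e n) (mkseq l p))); split=> [k kp|x [w wx]].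
    by rewrite (nth_map l0) ?size_mkseq// nth_mkseq// lP.
  have [l' lE] := dTP (mkseq l p, w); exists n.+1, l'.
  by rewrite /= /step lE.
have cB : pp_closed B.
  move=> s p u Bu hu; have [t [tu tB]] := finB u p Bu.
  have [k kp|h [Bh hs hp]] := hull_closed (t := t) _ hu.
    by rewrite -tu//; exact: hull_var.
  by exists h; split=> // k; exact: tB.
exists (submod_of (pp_submod cB)), (@submod_incl _ _ (pp_submod cB)); split.
- exact: pp_submod_pure.
- move=> n u.
  pose v k : H := if insub k is Some j then submod_incl (u j) else 0.
  have [k kn|t [tv tB]] := finB v n.
    by rewrite /v insubT; exact: (submod_inclP (u _)).
  exists (submod_of (pp_submod (hull_closed (t := t)))).
  have [|f [fl fE]] := @submod_corestrict _ _ (pp_submod cB) _ _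
    (@submod_incl_lin _ _ (pp_submod (hull_closed (t := t)))).
    by move=> x; apply: tB; exact: (submod_inclP x).
  exists f; split; last split.
  + exact: (pure_factor fl (@submod_incl_lin _ _ _) (pp_submod_pure _) fE).
  + apply: alg_compact_pure_injective; apply: pp_submod_alg_compact => // D m.
    exact: hull_meet.
  + move=> k; have [y yE] : exists y, @submod_incl _ _ (pp_submod (hull_closed (t := t))) y = submod_incl (u k).
      apply: submod_lift; have := tv k (ltn_ord k); rewrite /v valK => <-.
      exact: hull_var.
    by exists y; apply: submod_incl_inj; rewrite fE.
- apply: (cardle_trans _ (cardle_nat_prod Linf)).
  have [f fP] : exists f : submod_of (pp_submod cB) -> nat * L, forall x, e (f x).1 (f x).2 = submod_incl x.
    have /choice[f fP] : forall x : submod_of (pp_submod cB), exists nl, e nl.1 nl.2 = submod_incl x.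
      by move=> x; have [n [l nl]] := submod_inclP x; exists (n, l).
    by exists f.
  by exists f => x y xy; apply: (@submod_incl_inj _ _ (pp_submod cB)); rewrite -!fP xy.
- move=> a; apply: submod_lift; have [l lE] := dAP a.
  by exists 0%N, l; rewrite /= lE.
Qed.

(** * Superstability implies pure-semisimplicity *)

Section DirectSums.
Variables (R : nzRingType) (J : eqType) (V : lmodType R).

Definition fin_support (x : J -> V) : Prop := exists s : seq J, forall j, j \notin s -> x j = 0.

Fact fin_support0 : fin_support 0. Proof. by exists [::]. Qed.

Fact fin_supportP a x y : fin_support x -> fin_support y -> fin_support (a *: x + y).
Proof.
move=> [s sx] [u uy]; exists (s ++ u) => j; rewrite mem_cat negb_or => /andP[js ju].
by rewrite -[LHS]/(a *: x j + y j) sx// uy// scaler0 addr0.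
Qed.

Definition dsum : lmodType R := submod_of (Submod fin_support0 fin_supportP).

Definition dcoord (j : J) (x : dsum) : V := submod_incl x j.

Lemma dcoord_lin j : is_lin (dcoord j). Proof. by []. Qed.

Lemma dsum_eq (x y : dsum) : (forall j, dcoord j x = dcoord j y) -> x = y.
Proof. by move=> xy; apply: submod_incl_inj; apply/funext. Qed.

Lemma dsum_build (F : J -> V) : fin_support F -> exists x : dsum, forall j, dcoord j x = F j.
Proof.
move=> /(@submod_lift _ _ (Submod fin_support0 fin_supportP))[x xE].
by exists x => j; rewrite /dcoord xE.
Qed.

Lemma dsum_support (x : dsum) : fin_support (fun j => dcoord j x).
Proof. exact: (submod_inclP x). Qed.

Fact dinj_support j v : fin_support (fun k => if k == j then v else 0).
Proof. by exists [:: j] => k; rewrite inE => /negPf->. Qed.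

Definition dinj j v : dsum := projT1 (cid (dsum_build (dinj_support j v))).

Lemma dcoord_dinj j v k : dcoord k (dinj j v) = if k == j then v else 0.
Proof. exact: projT2 (cid (dsum_build (dinj_support j v))) k. Qed.

Lemma dinj_lin j : is_lin (dinj j).
Proof.
move=> a x y; apply: dsum_eq => k; rewrite dcoord_lin !dcoord_dinj.
by case: eqP => // _; rewrite scaler0 addr0.
Qed.

Lemma cardle_dsum (L : Type) : card_le nat L -> card_le J L -> card_le V L -> card_le dsum L.
Proof.
move=> Linf JL VL.
have JVL := cardle_trans (cardle_prod JL VL) (cardle_square Linf).
apply: cardle_trans (cardle_seq Linf).
have : card_le (seq (J * V)) (seq L) by have [f fI] := JVL; exists (map f); exact: inj_map.
apply: cardle_trans; have /choice[s sP] := dsum_support.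
exists (fun x => [seq (j, dcoord j x) | j <- s x]) => x y xy; apply: dsum_eq => j.
have sxy : s x = s y.
  by have := congr1 (map fst) xy; rewrite -!map_comp !map_id_in.
have [js|js] := boolP (j \in s x); last by rewrite !sP// -sxy.
have : (j, dcoord j x) \in [seq (j, dcoord j y) | j <- s y].
  by rewrite -xy; apply/mapP; exists j.
by move=> /mapP[k _ [-> ->]].
Qed.

End DirectSums.
Arguments dcoord : simpl never.

Section UniversalExtensions.
Variables (R : nzRingType) (K : lmodType R -> Prop).
Hypothesis lpiK : forall M, Rlpi M -> K M.
Variable L : Type.
Hypotheses (Linf : card_le nat L) (termL : card_le (pp_term R) L).

Lemma lift_along (N H A : lmodType R) (f : N -> H) (i : A -> H) : pure_emb f ->
  is_lin i -> (forall a, exists y, f y = i a) ->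
  exists q : A -> N, is_lin q /\ forall a, f (q a) = i a.
Proof.
move=> [fl [fI _]] il /choice[q qP]; exists q; split=> // a x y.
by apply: fI; rewrite qP il fl !qP.
Qed.

(** Points of an algebraically compact pure extension of [N] can be moved into [U]: with [N] they
    are enclosed in a locally pure-injective module of cardinality [L], which [lpiK] places in [K],
    and universality embeds that module over [N]. *)
Lemma universal_embed (N U H : lmodType R) (e : N -> U) (k : N -> H) (A : Type) (i : A -> H) :
  universal_over K L e -> alg_compact H -> pure_emb k -> card_le A L ->
  exists (N' : lmodType R) (c : N' -> H) (h : N' -> U),
    [/\ pure_emb c, pure_emb h, forall x, exists y, c y = k x /\ h y = e x
      & forall a, exists y, c y = i a].
Proof.
move=> [KN [KU [NL [UL [ep univ]]]]] acH kp AL.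
pose i' (z : N + A) := match z with inl x => k x | inr a => i a end.
have sumL : card_le (N + A) L.
  apply: cardle_trans (cardle_square Linf).
  have [j jI] := Linf; have [u uI] := has_size_le NL; have [v vI] := AL.
  exists (fun z => match z with inl x => (j 0%N, u x) | inr a => (j 1%N, v a) end).
  by move=> [x|x] [y|y] [] => [/uI->|/jI|/jI|/vI->].
have [N' [c [cp lpi N'L cP]]] := lpi_pure_submodule i' (inl 0 : N + A) acH Linf termL sumL.
have [|q [ql cq]] := lift_along cp kp.1 (fun x => _); first by move=> x; exact: (cP (inl x)).
have qp : pure_emb q by exact: pure_factor ql cp.1 kp cq.
have N's : has_size N' L.
  apply: cardle_antisym => //; apply: cardle_trans (has_size_ge NL) _.
  by exists q; case: qp => _ [].
have [h [hp hq]] := univ N' q (lpiK lpi) N's qp.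
exists N', c, h; split=> // [x|a]; last by exact: (cP (inr a)).
by exists (q x).
Qed.

End UniversalExtensions.

Lemma exists_succ (I : Type) (lt : I -> I -> Prop) (L : Type) i :
  limit_ordinal_below_succ L lt -> exists j, is_succ_of lt i j.
Proof.
move=> [wf [irr [tr [tot [_ [unb _]]]]]]; have [j ij] := unb i.
elim/(well_founded_ind wf): j ij => j IHj ij.
have [[k [ik kj]]|nk] := pselect (exists k, lt i k /\ lt k j); last by exists j.
exact: IHj kj ik.
Qed.

Section NotSuperstable.
Variables (R : nzRingType) (K : lmodType R -> Prop).
Hypothesis lpiK : forall M, Rlpi M -> K M.

(* From a strictly descending chain of pp-subgroups [s n] of [M] with witnesses [a n], the partial sums of [sum_n a_n e_(n, eta n)], for [eta : nat -> L], define [L ^ nat] pairwise distinct pp-types over [M ^ (nat * L)], all of them realised in a module of cardinality [L]. *)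
Lemma universal_chain_many_types (M : lmodType R) (s : nat -> lsys R) (a : nat -> M) (L : Type)
    (N0 N1 N2 : lmodType R) (e1 : N0 -> N1) (e2 : N1 -> N2) :
  pp_chain s a -> card_le nat L -> card_le (pp_term R) L -> card_le M L ->
  universal_over K L e1 -> universal_over K L e2 -> card_le (nat -> L) L.
Proof.
move=> sa Linf termL ML univ1 univ2.
pose J : eqType := (nat * {classic L})%type; pose P := dsum J M.
have PL : card_le P L by apply: cardle_dsum => //; exact: cardle_nat_prod.
(* [P] is adjoined to [N0] as a direct summand, and the product goes into its bidual, to which
   [universal_embed] applies. *)
have [e ep] : exists e : P -> N1, pure_emb e.
  pose H : lmodType R := (N0 * P)%type.
  pose i0 (x : N0) : H := (x, 0); pose i1 (x : P) : H := (0, x).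
  have i0p : pure_emb i0.
    by apply: (@pure_split _ _ _ _ fst) => // b x y; congr (_, _); rewrite /= scaler0 addr0.
  have i1p : pure_emb i1.
    by apply: (@pure_split _ _ _ _ snd) => // b x y; congr (_, _); rewrite /= scaler0 addr0.
  have evp := @bidual_ev_pure R H.
  have [N' [c [h [cp hp _ cP]]]] := universal_embed lpiK Linf termL
    (bidual_ev (M:=H) \o i1) univ1 (@bidual_alg_compact R H) (pure_comp evp i0p) PL.
  have [q [ql cq]] := lift_along cp (pure_comp evp i1p).1 cP.
  have qp := pure_factor ql cp.1 (pure_comp evp i1p) cq.
  by exists (h \o q); exact: pure_comp.
pose S (eta : nat -> L) n : P := \sum_(k < n) dinj ((k : nat), eta k : {classic L}) (a k).
have smono n m (x : M) : (n <= m)%N -> pp (s m) x -> pp (s n) x.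
  move=> /subnK <-; elim: (m - n)%N => [//|d IHd]; rewrite addSn.
  by have [_ _ sS] := sa (d + n)%N; move=> /sS/IHd.
have SB eta n m : (n <= m)%N -> pp (s n) (S eta m - S eta n).
  move=> /subnK <-; elim: (m - n)%N => [|d IHd]; first by rewrite subrr; exact: pp0.
  rewrite addSn /S big_ord_recr/= addrAC; apply: ppD; first exact: IHd.
  apply: pp_lin; first exact: dinj_lin.
  by apply: (smono n (d + n)%N); [exact: leq_addl|case: (sa (d + n)%N)].
pose E := e2 \o e; have Ep : pure_emb E.
  by apply: pure_comp => //; case: univ2 => _ [_ [_ [_ []]]].
(* The cosets of [E (S eta n)] modulo pp(s n) decrease with [n], so finitely many of them contain a
   later partial sum. The bidual of [N1] then contains a common point, which is moved into [N2]. *)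
have /choice[u uP] : forall eta : nat -> L, exists u, forall n, pp (s n) (u - E (S eta n)).
  move=> eta; pose ev := @bidual_ev R N1.
  have evp : pure_emb ev by exact: bidual_ev_pure.
  pose Psi s' m := exists n, s' = s n /\ m = ev (e (S eta n)).
  have [l|x xP] := @bidual_alg_compact R N1 Psi.
    have [m mP] : exists m, forall c, c \in l -> Psi c.1 c.2 ->
        exists n, [/\ (n <= m)%N, c.1 = s n & c.2 = ev (e (S eta n))].
      elim: l => [|c l [m mP]]; first by exists 0%N.
      have [[n [cs cm]]|nP] := pselect (Psi c.1 c.2); last first.
        by exists m => d; rewrite inE => /orP[/eqP-> //|]; exact: mP.
      exists (maxn m n) => d; rewrite inE => /orP[/eqP->|dl] Pd.
        by exists n; rewrite leq_maxr.
      by have [n' [n'm ds dm]] := mP d dl Pd; exists n'; rewrite leq_max n'm.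
    exists (ev (e (S eta m))) => c cl Pc; have [n [nm -> ->]] := mP c cl Pc.
    rewrite -(is_linB _ _ evp.1) -(is_linB _ _ ep.1).
    by apply: pp_lin evp.1 _; apply: pp_lin ep.1 _; exact: SB.
  have uL : card_le unit L by have [j jI] := Linf; exists (fun=> j 0%N) => -[] [].
  have [N' [c [h [cp hp cN cP]]]] := universal_embed lpiK Linf termL
    (fun _ : unit => x) univ2 (@bidual_alg_compact R N1) evp uL.
  have [y yx] := cP tt; exists (h y) => n.
  have [z [cz hz]] := cN (e (S eta n)); rewrite /E /= -hz -(is_linB _ _ hp.1).
  apply: pp_lin hp.1 _; apply: (pp_pure cp); rewrite (is_linB _ _ cp.1) yx cz.
  by apply: xP; exists n.
have N2L : card_le N2 L by apply: has_size_le; case: univ2 => _ [_ [_ []]].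
apply: cardle_trans N2L; exists u => eta theta uu; apply/funext => n.
apply: contrapT => nn; have [sn an _] := sa n; apply: an.
(* Here [n] is any place where [eta] and [theta] differ. The coordinate [(n, eta n)] of the
   difference of the partial sums is [a n], which would therefore satisfy [s n.+1]. *)
have : pp (s n.+1) (E (S eta n.+1 - S theta n.+1)).
  rewrite (is_linB _ _ Ep.1).
  have -> : E (S eta n.+1) - E (S theta n.+1) =
      (u theta - E (S theta n.+1)) - (u eta - E (S eta n.+1)).
    by rewrite uu opprB [RHS]addrC addrA subrK.
  by apply: ppB; exact: uP.
move=> /(pp_pure Ep)/(pp_lin (dcoord_lin (n, eta n : {classic L}))).
rewrite (is_linB _ _ (dcoord_lin _)) /S !(is_lin_sum _ _ _ (dcoord_lin _)).
rewrite big_ord_recr/= big1 => [|k _]; last first.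
  by rewrite dcoord_dinj xpair_eqE gtn_eqF// ltn_ord.
rewrite big1 => [|k _].
  by rewrite dcoord_dinj eqxx add0r subr0.
rewrite dcoord_dinj xpair_eqE; case: (n =P k :> nat) => //= nk.
by case: eqP => // et; case: nn; rewrite et; congr theta; exact/esym.
Qed.

Lemma superstable_pure_semisimple : superstable K -> left_pure_semisimple R.
Proof.
move=> [mu sup] M; apply: contrapT => npi.
have [s [a sa]] : exists s a, @pp_chain R M s a.
  apply: contrapT => nc; apply: npi; apply: alg_compact_pure_injective.
  exact: no_pp_chain_alg_compact.
(* [A] gathers all the lower bounds that [L] has to meet: the threshold [mu], the size of [M], the
   number of terms, and infinity. *)
pose A := (mu + (M + (pp_term R + nat)))%type; pose L := beth_omega A.
have AL : card_le A L := @beth_omega_ge A.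
have inlL B C : card_le B (B + C) by exists inl => x y [].
have inrL B C : card_le C (B + C) by exists inr => x y [].
have A2 : card_le (M + (pp_term R + nat)) L := cardle_trans (inrL _ _) AL.
have A3 : card_le (pp_term R + nat) L := cardle_trans (inrL _ _) A2.
have [[X [_ [I [lt [Ms [f [g [ord [_ [_ [_ [_ [_ [univ _]]]]]]]]]]]]]] _] :=
  sup L (cardle_trans (inlL _ _) AL).
have [i0] : inhabited I by case: (ord) => _ [_ [_ [_ []]]].
have [i1 s1] := exists_succ i0 ord; have [i2 s2] := exists_succ i1 ord.
apply: (@beth_omega_koenig A).
apply: (universal_chain_many_types sa _ _ _ (univ _ _ s1) (univ _ _ s2)).
- exact: cardle_trans (inrL _ _) A3.
- exact: cardle_trans (inlL _ _) A3.
- exact: cardle_trans (inlL _ _) A2.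
Qed.

End NotSuperstable.

(** * Finitely presented modules *)

Section DirectSumMaps.
Variables (R : nzRingType) (J : eqType) (V : lmodType R).

Definition dsum_map (M : lmodType R) (phi : J -> V -> M) (x : dsum J V) : M :=
  \sum_(j <- undup (projT1 (cid (dsum_support x)))) phi j (dcoord j x).

Lemma dsum_mapE (M : lmodType R) (phi : J -> V -> M) (x : dsum J V) (s : seq J) :
  (forall j, is_lin (phi j)) -> uniq s -> (forall j, j \notin s -> dcoord j x = 0) ->
  dsum_map phi x = \sum_(j <- s) phi j (dcoord j x).
Proof.
move=> pl us sx; rewrite /dsum_map; case: cid => u /= ux.
have red (w : seq J) : uniq w -> (forall j, j \notin w -> dcoord j x = 0) ->
    \sum_(j <- w) phi j (dcoord j x) =
    \sum_(j <- [seq j <- w | dcoord j x != 0]) phi j (dcoord j x).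
  move=> _ _; rewrite big_filter [RHS]big_mkcond; apply: eq_bigr => j _.
  by case: eqP => //= ->; rewrite is_lin0.
have undup_x j : j \notin undup u -> dcoord j x = 0 by rewrite mem_undup; exact: ux.
rewrite red ?undup_uniq// [RHS]red//; apply/perm_big/uniq_perm; rewrite ?filter_uniq ?undup_uniq//.
move=> j; rewrite !mem_filter mem_undup; case: eqP => //= x0.
have -> : j \in u by apply: contraT => /ux.
have -> : j \in s by apply: contraT => /sx.
by [].
Qed.

Lemma dsum_map_lin (M : lmodType R) (phi : J -> V -> M) :
  (forall j, is_lin (phi j)) -> is_lin (dsum_map phi).
Proof.
move=> pl a x y; have [[sx sxP] [sy syP]] := (dsum_support x, dsum_support y).
pose s := undup (sx ++ sy).
have sP j : j \notin s -> dcoord j x = 0 /\ dcoord j y = 0.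
  by rewrite mem_undup mem_cat negb_or => /andP[/sxP-> /syP->].
have [sx0 sy0] : (forall j, j \notin s -> dcoord j x = 0) /\ (forall j, j \notin s -> dcoord j y = 0).
  by split=> j /sP[].
have E z : (forall j, j \notin s -> dcoord j z = 0) ->
    dsum_map phi z = \sum_(j <- s) phi j (dcoord j z).
  by apply: dsum_mapE => //; exact: undup_uniq.
rewrite (E x sx0) (E y sy0) E; last first.
  by move=> j /sP[x0 y0]; rewrite dcoord_lin x0 y0 scaler0 addr0.
rewrite scaler_sumr -big_split/=; apply: eq_bigr => j _.
by rewrite dcoord_lin pl.
Qed.

Lemma dsum_map_dinj (M : lmodType R) (phi : J -> V -> M) j v :
  (forall j, is_lin (phi j)) -> dsum_map phi (dinj j v) = phi j v.
Proof.
move=> pl; rewrite (@dsum_mapE _ _ _ [:: j])// ?big_seq1 ?dcoord_dinj ?eqxx//.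
by move=> k; rewrite inE dcoord_dinj => /negPf->.
Qed.

End DirectSumMaps.

Section Quotient.
Variables (R : nzRingType) (M : lmodType R) (H : submod M).

(** [choose] depends only on the extension of its predicate once the default satisfies it, so [qrep]
    is constant on cosets; the quotient is the set of chosen representatives. *)
Definition qrep (x : M) : M := choose (fun y => `[< H (x - y) >]) x.

Lemma submodB x y : H x -> H y -> H (x - y).
Proof. by move=> Hx Hy; rewrite addrC -scaleN1r; exact: submodP. Qed.

Lemma qrepP x : H (x - qrep x).
Proof.
apply/asboolP; apply: (@chooseP _ (fun y => `[< H (x - y) >])).
by apply/asboolP; rewrite subrr; exact: submod0.
Qed.

Lemma qrep_eq x y : H (x - y) -> qrep x = qrep y.
Proof.
move=> Hxy; have Pxy : (fun z => `[< H (x - z) >]) =1 (fun z => `[< H (y - z) >]).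
  move=> z; apply/asboolP/asboolP => Hz.
    have -> : y - z = (x - z) - (x - y) by rewrite opprB [RHS]addrC addrA subrK.
    exact: submodB.
  have -> : x - z = (x - y) + (y - z) by rewrite addrA subrK.
  by rewrite -[x - y]scale1r; exact: submodP.
rewrite /qrep (eq_choose Pxy); apply: choose_id; last by apply/asboolP; rewrite subrr; exact: submod0.
by rewrite -Pxy; apply/asboolP; rewrite subrr; exact: submod0.
Qed.

Record quotient := Quotient { qval : M; _ : qrep qval == qval }.
HB.instance Definition _ := [isSub for qval].
HB.instance Definition _ := [Choice of quotient by <:].

Fact qpi_subproof x : qrep (qrep x) == qrep x.
Proof. by apply/eqP; apply/esym/qrep_eq/qrepP. Qed.

Definition qpi x : quotient := Quotient (qpi_subproof x).

Lemma qpi_eq x y : H (x - y) -> qpi x = qpi y.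
Proof. by move=> /qrep_eq xy; apply: val_inj. Qed.

Lemma qvalK : cancel qval qpi.
Proof. by move=> u; apply: val_inj; apply/eqP; case: u. Qed.

Lemma qpi_valP x : H (x - qval (qpi x)). Proof. exact: qrepP. Qed.

Definition qadd u v := qpi (qval u + qval v).
Definition qopp u := qpi (- qval u).
Definition qscale a u := qpi (a *: qval u).

Lemma qpiD x y : qadd (qpi x) (qpi y) = qpi (x + y).
Proof.
apply/esym/qpi_eq; rewrite opprD addrACA -[x - _]scale1r.
by apply: submodP; exact: qpi_valP.
Qed.

Lemma qpiN x : qopp (qpi x) = qpi (- x).
Proof.
apply: qpi_eq; rewrite opprK addrC; exact: qpi_valP.
Qed.

Lemma qpiZ a x : qscale a (qpi x) = qpi (a *: x).
Proof.
apply/esym/qpi_eq; rewrite -scalerBr -[a *: _]addr0.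
by apply: submodP; [exact: qpi_valP|exact: submod0].
Qed.

Fact qaddA : associative qadd.
Proof.
move=> u v w; rewrite -(qvalK u) -(qvalK v) -(qvalK w) !qpiD.
by rewrite addrA.
Qed.
Fact qaddC : commutative qadd.
Proof. by move=> u v; rewrite /qadd addrC. Qed.
Fact qadd0 : left_id (qpi 0) qadd.
Proof. by move=> u; rewrite -(qvalK u) qpiD add0r. Qed.
Fact qaddN : left_inverse (qpi 0) qopp qadd.
Proof. by move=> u; rewrite -(qvalK u) qpiN qpiD addNr. Qed.

HB.instance Definition _ := GRing.isZmodule.Build quotient qaddA qaddC qadd0 qaddN.

Fact qscaleA a b u : qscale a (qscale b u) = qscale (a * b) u.
Proof. by rewrite -(qvalK u) !qpiZ scalerA. Qed.
Fact qscale1 : left_id 1 qscale.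
Proof. by move=> u; rewrite -(qvalK u) qpiZ scale1r. Qed.
Fact qscaleDr : right_distributive qscale +%R.
Proof.
move=> a u v; rewrite -(qvalK u) -(qvalK v).
by rewrite ![in RHS]qpiZ -![qpi _ + qpi _]/(qadd _ _) !qpiD qpiZ scalerDr.
Qed.
Fact qscaleDl u : {morph qscale^~ u : a b / a + b}.
Proof.
move=> a b; rewrite -(qvalK u) /= !qpiZ -[RHS]/(qadd _ _) qpiD.
by rewrite scalerDl.
Qed.

HB.instance Definition _ := GRing.Zmodule_isLmodule.Build R quotient
  qscaleA qscale1 qscaleDr qscaleDl.

Lemma qpi_lin : is_lin (qpi : M -> quotient).
Proof.
by move=> a x y; rewrite -[RHS]/(qadd (qscale _ _) _) qpiZ qpiD.
Qed.

Lemma quotient_factor (N : lmodType R) (f : M -> N) : is_lin f -> (forall x, H x -> f x = 0) ->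
  exists g : quotient -> N, is_lin g /\ forall x, g (qpi x) = f x.
Proof.
move=> fl fH; have fE x : f (qval (qpi x)) = f x.
  by apply/esym/eqP; rewrite -subr_eq0 -is_linB//; apply/eqP/fH/qpi_valP.
exists (fun u => f (qval u)); split=> [a u v|]; last exact: fE.
by rewrite -(qvalK u) -(qvalK v) -qpi_lin !fE fl.
Qed.

End Quotient.

Section FinitelyPresented.
Variable R : nzRingType.

Definition gens : lmodType R := dsum (lsys R * nat)%type (R^o : lmodType R).
Definition gen0 (s : lsys R) (k : nat) : gens := dinj (s, k) (1 : R^o).

Definition rels_mem (x : gens) : Prop := forall S : submod gens,
  (forall s t, t \in s -> S (leval t (gen0 s))) -> S x.
Fact rels0 : rels_mem 0. Proof. by move=> S _; exact: submod0. Qed.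
Fact relsP a x y : rels_mem x -> rels_mem y -> rels_mem (a *: x + y).
Proof. by move=> Hx Hy S SP; apply: submodP; [exact: Hx|exact: Hy]. Qed.

(* The direct sum, over all finite linear systems [s], of the module generated by a generic solution [gen s] of [s]. *)
Definition fpmod : lmodType R := quotient (Submod rels0 relsP).
Definition gen (s : lsys R) (k : nat) : fpmod := qpi (Submod rels0 relsP) (gen0 s k).

Lemma gen_sol s : lsol s (gen s).
Proof.
move=> t ts; rewrite -(leval_lin t (gen0 s) (@qpi_lin _ _ _)).
rewrite -[RHS](is_lin0 (@qpi_lin _ _ (Submod rels0 relsP))); apply: qpi_eq.
by rewrite subr0 => S SP; exact: SP.
Qed.

Lemma gen_universal (M : lmodType R) s (y : nat -> M) : lsol s y ->
  exists h : fpmod -> M, is_lin h /\ forall k, h (gen s k) = y k.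
Proof.
(* Generators attached to the other systems go to [0], which solves every homogeneous system. *)
move=> ys; pose phi (c : lsys R * nat) (r : R^o) : M := if c.1 == s then r *: y c.2 else 0.
have pl c : is_lin (phi c).
  move=> a r r'; rewrite /phi; case: ifP => _; last by rewrite scaler0 addr0.
  by rewrite scalerDl scalerA.
have ml := dsum_map_lin pl.
have mg s' k : dsum_map phi (gen0 s' k) = if s' == s then y k else 0.
  by rewrite dsum_map_dinj// /phi /=; case: ifP => // _; rewrite scale1r.
pose ker x := dsum_map phi x = 0.
have ker0 : ker 0 by exact: is_lin0.
have kerP a x z : ker x -> ker z -> ker (a *: x + z).
  by rewrite /ker ml => -> ->; rewrite scaler0 addr0.
have [|h [hl hE]] := @quotient_factor _ _ (Submod rels0 relsP) _ (dsum_map phi) ml.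
  move=> x /(_ (Submod ker0 kerP)); apply=> s' t ts.
  rewrite -[submod_mem _ _]/(ker _) /ker leval_lin//; have [s's|ns] := eqVneq s' s.
    rewrite -(ys t) -?s's//; congr leval; apply/funext => k.
    by rewrite /= mg s's eqxx.
  rewrite /leval big1// => p _; by rewrite /= mg (negPf ns) scaler0.
by exists h; split=> // k; rewrite hE mg eqxx.
Qed.

(** The constant sequence [1] of [R] solves the empty system. A nonzero element is needed later to
    find [L] distinct elements in the models of the chain. *)
Lemma gen_neq0 : gen [::] 0 != 0.
Proof.
have [|h [hl hE]] := @gen_universal (R^o : lmodType R) [::] (fun=> 1); first by [].
apply/eqP => g0; have := hE 0%N; rewrite g0 is_lin0// => /esym/eqP.
by rewrite oner_eq0.
Qed.

Lemma cardle_fpmod (L : Type) : card_le nat L -> card_le (lsys R) L -> card_le fpmod L.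
Proof.
move=> Linf sL; apply: (@cardle_trans gens).
  by exists (@qval _ _ _); exact: val_inj.
apply: cardle_dsum => //.
  exact: cardle_trans (cardle_prod sL Linf) (cardle_square Linf).
by apply: cardle_trans sL; exists (fun r => [:: [:: (r, 0%N)]]) => r r' [].
Qed.

End FinitelyPresented.

(** * Pure-semisimplicity implies superstability *)

Section Isomorphisms.
Variable R : nzRingType.
Implicit Types M N P X : lmodType R.

Definition iso M N : Prop := exists h : M -> N, is_lin h /\ bijective h.

Lemma iso_can M N (h : M -> N) (g : N -> M) :
  is_lin h -> cancel h g -> cancel g h -> iso M N.
Proof. by move=> hl hK gK; exists h; split=> //; exists g. Qed.

Lemma iso_sym M N : iso M N -> iso N M.
Proof.
move=> [h [hl [g hK gK]]]; apply: (iso_can (h := g) (g := h)) => // a x y.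
by apply: (can_inj hK); rewrite hl !gK.
Qed.

Lemma iso_trans N M P : iso M N -> iso N P -> iso M P.
Proof.
move=> [h [hl hb]] [g [gl gb]]; exists (g \o h); split; first exact: is_lin_comp.
exact: bij_comp.
Qed.

Lemma iso_prodC M N : iso (M * N)%type (N * M)%type.
Proof.
apply: (@iso_can (M * N)%type (N * M)%type (fun p => (p.2, p.1)) (fun p => (p.2, p.1))) => //; by case.
Qed.

Lemma iso_prod M N P : iso N P -> iso (M * N)%type (M * P)%type.
Proof.
move=> [h [hl [g hK gK]]].
apply: (@iso_can (M * N)%type (M * P)%type (fun p => (p.1, h p.2)) (fun p => (p.1, g p.2))).
- by move=> a [x1 x2] [y1 y2]; congr (_, _); exact: hl.
- by move=> [x y] /=; rewrite hK.
- by move=> [x y] /=; rewrite gK.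
Qed.

Lemma dsum_functor (J : eqType) M N (h : M -> N) : is_lin h ->
  exists H : dsum J M -> dsum J N, is_lin H /\ forall j x, dcoord j (H x) = h (dcoord j x).
Proof.
move=> hl; have /choice[H HP] : forall x : dsum J M, exists y : dsum J N,
    forall j, dcoord j y = h (dcoord j x).
  move=> x; apply: dsum_build; have [s sx] := dsum_support x.
  by exists s => j /sx ->; exact: is_lin0.
exists H; split=> // a x y; apply: dsum_eq => j.
by rewrite HP !dcoord_lin !HP hl.
Qed.

Lemma iso_dsum (J : eqType) M N : iso M N -> iso (dsum J M) (dsum J N).
Proof.
move=> MN; have [g [gl _]] := iso_sym MN.
case: MN => h [hl [g' hK gK]].
have g'l : is_lin g' by move=> a x y; apply: (can_inj hK); rewrite hl !gK.
have [H [Hl HP]] := dsum_functor J hl; have [G [Gl GP]] := dsum_functor J g'l.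
by apply: (iso_can (g := G) Hl) => x; apply: dsum_eq => j; rewrite ?HP ?GP ?HP ?hK ?gK.
Qed.

Fact ker_mem0 M N (f : M -> N) (fl : is_lin f) : f 0 = 0.
Proof. exact: is_lin0. Qed.

Fact ker_memP M N (f : M -> N) (fl : is_lin f) a x y : f x = 0 -> f y = 0 -> f (a *: x + y) = 0.
Proof. by rewrite fl => -> ->; rewrite scaler0 addr0. Qed.

Definition ker_mod M N (f : M -> N) (fl : is_lin f) : submod M :=
  @Submod R M (fun x => f x = 0) (ker_mem0 fl) (ker_memP fl).

Lemma iso_split M X (sigma : X -> M) (pi : M -> X) (pl : is_lin pi) :
  is_lin sigma -> cancel sigma pi -> iso M (X * submod_of (ker_mod pl))%type.
Proof.
move=> sl sK.
have [||k [kl kE]] := @submod_corestrict _ _ (ker_mod pl) _ (fun x => x - sigma (pi x)).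
- move=> a x y; by rewrite pl sl scalerBr opprD addrACA.
- by move=> x; rewrite -[submod_mem _ _]/(pi _ = 0) is_linB// sK subrr.
apply: (@iso_can M (X * submod_of (ker_mod pl))%type (fun x => (pi x, k x))
    (fun p => sigma p.1 + submod_incl p.2)).
- by move=> a x y; congr (_, _); [exact: pl|exact: kl].
- by move=> x /=; rewrite kE addrC subrK.
- move=> [x y] /=; have y0 : pi (submod_incl y) = 0 by exact: (submod_inclP y).
  have px : pi (sigma x + submod_incl y) = x by rewrite is_linD// y0 addr0 sK.
  congr (_, _) => //; apply: submod_incl_inj; rewrite kE px.
  by rewrite addrC addKr.
Qed.

(** Hilbert's hotel on the [M]-components alone: they move by one place while the [N]-components
    stay. *)
Lemma iso_dsum_shift M N : iso (dsum nat (M * N)%type) (M * dsum nat (M * N)%type)%type.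
Proof.
pose MN : lmodType R := (M * N)%type; pose D := dsum nat MN.
have /choice[f fE] : forall x : D, exists y : D,
    forall n, dcoord n y = ((dcoord n.+1 x).1, (dcoord n x).2).
  move=> x; apply: dsum_build; have [s sx] := dsum_support x.
  exists (s ++ map predn s) => n; rewrite mem_cat negb_or => /andP[ns npn].
  rewrite (sx n)// sx//; apply: contra npn => ns'.
  by apply/mapP; exists n.+1.
have /choice[g gE] : forall p : M * D, exists y : D, forall n,
    dcoord n y = (if n is n'.+1 then (dcoord n' p.2).1 else p.1, (dcoord n p.2).2).
  move=> [m x]; apply: dsum_build; have [s sx] := dsum_support x.
  exists (0%N :: s ++ map succn s) => -[|n]; rewrite inE//= mem_cat negb_or => /andP[ns nsn].
  rewrite (sx n.+1)// (sx n)//; apply: contra nsn => ns'; exact: map_f.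
apply: (@iso_can D (M * D)%type (fun x => ((dcoord 0%N x).1, f x)) g).
- move=> a x y; congr (_, _); apply: dsum_eq => n.
  by rewrite dcoord_lin !fE !dcoord_lin.
- move=> x; apply: dsum_eq => n; rewrite gE /= !fE.
  by case: n => [|n]; rewrite ?fE /=; case: (dcoord _ x).
- move=> [m x]; rewrite gE /=; congr (_, _); apply: dsum_eq => n.
  by rewrite fE !gE /=; case: (dcoord n x).
Qed.

End Isomorphisms.

Section PureSemisimple.
Variable R : nzRingType.
Hypothesis pss : left_pure_semisimple R.
Variable L : Type.
Hypotheses (Linf : card_le nat L) (sysL : card_le (lsys R) L).
Implicit Types M N X : lmodType R.

Definition fpsum : lmodType R := dsum {classic L} (fpmod R).
Definition fpsumN : lmodType R := dsum nat fpsum.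

Lemma cardle_fpsumN : card_le fpsumN L.
Proof.
apply: cardle_dsum => //; apply: cardle_dsum => //; first exact: cardle_refl.
exact: cardle_fpmod.
Qed.

(* [M] is the image of [fpsum] under a map with pure kernel, which splits: a finite system over the kernel solved in [fpsum] is corrected by a generic solution of the homogeneous system satisfied by the images in [M]. *)
Lemma split_fpsum M : card_le M L ->
  exists (sigma : M -> fpsum) (pi : fpsum -> M), [/\ is_lin sigma, is_lin pi & cancel sigma pi].
Proof.
move=> ML.
(* Each of the [L] summands is assigned a system and a finite tuple of [M], padded by [0], and is
   mapped to [M] by the generic solution when the tuple solves the system. *)
have [d dP] : exists d : L -> lsys R * seq M, forall c, exists l, d l = c.
  apply: cardle_decode; first exact: ([::], [::]).
  apply: cardle_trans (cardle_square Linf); apply: cardle_prod => //.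
  have [f fI] := ML; apply: cardle_trans (cardle_seq Linf).
  by exists (map f); exact: inj_map.
have /choice[h hP] : forall c : lsys R * seq M, exists h : fpmod R -> M, is_lin h /\
    (lsol c.1 (nth 0 c.2) -> forall k, h (gen c.1 k) = nth 0 c.2 k).
  move=> [s y]; have [ys|nys] := pselect (lsol s (nth 0 y)).
    by have [h [hl hE]] := gen_universal ys; exists h.
  by exists (fun=> 0); split=> // a x z; rewrite scaler0 addr0.
pose phi (l : {classic L}) := h (d l).
have pl l : is_lin (phi l) by exact: (hP (d l)).1.
pose pi : fpsum -> M := dsum_map phi; have pil : is_lin pi by exact: dsum_map_lin.
have pi_gen s (y : seq M) : lsol s (nth 0 y) ->
    exists l : {classic L}, forall k, pi (dinj l (gen s k)) = nth 0 y k.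
  move=> ys; have [l dl] := dP (s, y); exists l => k.
  by rewrite /pi dsum_map_dinj// /phi dl; exact: (hP (s, y)).2.
have pi_surj m : exists x, pi x = m.
  have [|l lE] := pi_gen [::] [:: m]; first by [].
  by exists (dinj l (gen [::] 0)); rewrite lE.
pose Ker : lmodType R := submod_of (ker_mod pil); pose i : Ker -> fpsum := @submod_incl _ _ (ker_mod pil).
have ip : pure_emb i.
  apply: pure_of_solve => [||E [x xE]]; [exact: submod_incl_lin|exact: submod_incl_inj|].
  have [n nP] := lterm_bound [seq e.1 | e <- E].
  have leq_n (T : lmodType R) (u v : nat -> T) e : e \in E ->
      (forall k, (k < n)%N -> u k = v k) -> leval e.1 u = leval e.1 v.
    move=> eE uv; rewrite /leval big_seq [RHS]big_seq; apply: eq_bigr => p pe.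
    by rewrite uv//; apply: nP pe; exact: map_f.
  have [|l lE] := pi_gen [seq e.1 | e <- E] (mkseq (pi \o x) n).
    move=> t /mapP[e eE ->]; rewrite (leq_n _ _ (pi \o x))//.
      by rewrite -leval_lin// xE//; exact: (submod_inclP e.2).
    by move=> k kn; rewrite nth_mkseq.
  pose x' k := dinj l (gen [seq e.1 | e <- E] k).
  have x'E e : e \in E -> leval e.1 x' = 0.
    move=> eE; rewrite -[LHS](leval_lin e.1 (gen [seq e.1 | e <- E]) (dinj_lin l)).
    by rewrite gen_sol ?is_lin0 ?map_f//; exact: dinj_lin.
  have /choice[z zE] : forall k, exists z : Ker, (k < n)%N -> i z = x k - x' k.
    move=> k; have [kn|_] := boolP (k < n)%N; last by exists 0.
    have [|z zE] := @submod_lift _ _ (ker_mod pil) (x k - x' k); last by exists z.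
    by rewrite -[submod_mem _ _]/(pi _ = 0) is_linB// /x' lE nth_mkseq// subrr.
  exists z => e eE; apply: (@submod_incl_inj _ _ (ker_mod pil)).
  rewrite leval_lin; last exact: submod_incl_lin.
  rewrite (leq_n _ _ (fun k => x k - x' k))// levalB x'E// subr0; exact: xE.
have [r [rl rK]] := pss ip.
have /choice[w wP] := pi_surj.
(* Subtracting the retraction onto the kernel leaves something that depends only on [pi x]; this
   makes the section linear although the choice [w] of preimages is not. *)
have sE x : x - i (r x) = w (pi x) - i (r (w (pi x))).
  have [y yE] : exists y, i y = x - w (pi x).
    by apply: submod_lift; rewrite -[submod_mem _ _]/(pi _ = 0) is_linB// wP subrr.
  have -> : x = i y + w (pi x) by rewrite yE subrK.
  have e : pi (i y + w (pi x)) = pi x.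
    by rewrite is_linD// wP (submod_inclP y) add0r.
  rewrite e (is_linD _ _ rl) rK (is_linD _ _ ip.1).
  by rewrite opprD addrACA subrr add0r.
have piK x : pi (x - i (r x)) = pi x.
  by rewrite is_linB// (submod_inclP (r x)) subr0.
exists (fun m => w m - i (r (w m))), pi; split=> // [a m m'|m]; last by rewrite piK wP.
have := sE (a *: w m + w m'); rewrite pil !wP => <-.
by rewrite rl ip.1 scalerBr opprD addrACA.
Qed.

(* Eilenberg's swindle. *)
Lemma iso_absorb X : card_le X L -> iso fpsumN (X * fpsumN)%type.
Proof.
move=> XL; have [sigma [pi [sl pl sK]]] := split_fpsum XL.
have := iso_split pl sl sK; set Y := submod_of _ => fpsumXY.
have WD := iso_dsum nat fpsumXY.
apply: (iso_trans WD); apply: (iso_trans (iso_dsum_shift X Y)).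
by apply: iso_prod; exact: iso_sym.
Qed.

(** A pure copy of [fpsumN] splits off, and [fpsumN] absorbs its complement. *)
Lemma iso_fpsumN X : card_le X L -> (exists j : fpsumN -> X, pure_emb j) -> iso X fpsumN.
Proof.
move=> XL [j jp]; have [r [rl rK]] := pss jp.
have := iso_split rl jp.1 rK; set Z := submod_of _ => XWZ.
have ZL : card_le Z L.
  by apply: cardle_trans XL; exists (@submod_incl _ _ _); exact: submod_incl_inj.
apply: (iso_trans XWZ); apply: (iso_trans (iso_prodC _ _)).
exact: iso_sym (iso_absorb ZL).
Qed.

(** One universal step puts a pure copy of [fpsumN] into the model: the product of [Ms i0] and
    [fpsumN] is a pure extension of [Ms i0] of cardinality [L], so it embeds in [Ms i1]. *)
Lemma limit_model_iso X : limit_model (@RMod R) L X -> iso X fpsumN.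
Proof.
move=> [_ [I [lt [Ms [f [g [ord [sz [_ [_ [_ [_ [univ [gp [_ gcov]]]]]]]]]]]]]]].
have IL : card_le I L by case: ord => _ [_ [_ [_ [_ []]]]].
apply: iso_fpsumN.
  have /choice[u uP] : forall x, exists p : {i & Ms i}, g (projT1 p) (projT2 p) = x.
    by move=> x; have [i [y <-]] := gcov x; exists (existT _ i y).
  apply: (@cardle_trans (I * L)); last first.
    by apply: cardle_trans (cardle_square Linf); apply: cardle_prod => //; exact: cardle_refl.
  pose c i := projT1 (cid (has_size_le (sz i).2)).
  have cI i : injective (c i) := projT2 (cid (has_size_le (sz i).2)).
  pose cc (p : {i & Ms i}) := (projT1 p, c _ (projT2 p)).
  have ccI : injective cc.
    by move=> [i v] [j w] [ij]; move: w; rewrite -ij => w /cI ->.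
  by exists (cc \o u) => x y /ccI uxy; rewrite -(uP x) -(uP y) uxy.
have [i0] : inhabited I by case: (ord) => _ [_ [_ [_ []]]].
have [i1 s01] := exists_succ i0 ord.
have [_ [_ [sz0 [_ [ep ext]]]]] := univ _ _ s01.
pose NW : lmodType R := (Ms i0 * fpsumN)%type.
have ip : pure_emb ((fun x => (x, 0)) : Ms i0 -> NW).
  by apply: (@pure_split _ _ _ _ fst) => // b x y; congr (_, _); rewrite /= scaler0 addr0.
have jp : pure_emb ((fun x => (0, x)) : fpsumN -> NW).
  by apply: (@pure_split _ _ _ _ snd) => // b x y; congr (_, _); rewrite /= scaler0 addr0.
have NWL : has_size NW L.
  apply: cardle_antisym.
    apply: cardle_trans (cardle_square Linf); apply: cardle_prod; last exact: cardle_fpsumN.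
    exact: has_size_le.
  by apply: cardle_trans (has_size_ge sz0) _; exists (fun x => (x, 0)) => x y [].
have [//|h [hp _]] := ext NW _ _ NWL ip.
exists (g i1 \o (h \o (fun x => (0, x)))).
exact: pure_comp (gp i1) (pure_comp hp jp).
Qed.

(** [le_mod n] below is the power of [fpsum] with exponent n + 1, realised inside [fpsumN] so that
    the union of the chain is visible. *)
Definition le_mem n (x : fpsumN) : Prop := forall k, (n < k)%N -> dcoord k x = 0.

Fact le_mem0 n : le_mem n 0.
Proof. by move=> k _; exact: (is_lin0 (dcoord_lin k)). Qed.

Fact le_memP n a x y : le_mem n x -> le_mem n y -> le_mem n (a *: x + y).
Proof. by move=> x0 y0 k nk; rewrite dcoord_lin x0// y0// scaler0 addr0. Qed.

Definition le_submod n : submod fpsumN := Submod (@le_mem0 n) (@le_memP n).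
Definition le_mod n : lmodType R := submod_of (le_submod n).
Definition le_incl n : le_mod n -> fpsumN := @submod_incl _ _ (le_submod n).

Lemma le_incl_lin n : is_lin (@le_incl n). Proof. by []. Qed.
Lemma le_incl_inj n : injective (@le_incl n). Proof. exact: submod_incl_inj. Qed.

Lemma le_inclP n (x : le_mod n) k : (n < k)%N -> dcoord k (le_incl x) = 0.
Proof. exact: (submod_inclP x). Qed.

Lemma le_trunc_ex n (x : fpsumN) : exists y : le_mod n, forall k,
  dcoord k (le_incl y) = if (k <= n)%N then dcoord k x else 0.
Proof.
have [|z zE] := @dsum_build R nat fpsum (fun k => if (k <= n)%N then dcoord k x else 0).
  by have [s sx] := dsum_support x; exists s => j /sx ->; case: ifP.
have [|y yE] := @submod_lift _ _ (le_submod n) z.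
  by move=> k; rewrite zE ltnNge; case: leqP.
by exists y => k; rewrite /le_incl yE zE.
Qed.

Definition le_trunc n (x : fpsumN) : le_mod n := projT1 (cid (le_trunc_ex n x)).

Lemma le_truncE n x k : dcoord k (le_incl (le_trunc n x)) = if (k <= n)%N then dcoord k x else 0.
Proof. exact: (projT2 (cid (le_trunc_ex n x))). Qed.

Lemma le_trunc_lin n : is_lin (le_trunc n).
Proof.
move=> a x y; apply/le_incl_inj/dsum_eq => k.
rewrite le_incl_lin [RHS]dcoord_lin !le_truncE dcoord_lin.
by case: ifP => // _; rewrite scaler0 addr0.
Qed.

Lemma le_truncK n m (x : le_mod n) : (n <= m)%N -> le_incl (le_trunc m (le_incl x)) = le_incl x.
Proof.
move=> nm; apply: dsum_eq => k; rewrite le_truncE; case: leqP => // mk.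
by rewrite le_inclP//; exact: leq_ltn_trans nm mk.
Qed.

Lemma has_size_le_mod n : has_size (le_mod n) L.
Proof.
apply: cardle_antisym.
  by apply: cardle_trans cardle_fpsumN; exists (@le_incl n); exact: le_incl_inj.
pose b (l : {classic L}) : fpsum := dinj l (gen [::] 0 : fpmod R).
exists (fun l => le_trunc n (dinj 0%N (b l))) => l l' /(congr1 (@le_incl n)).
move=> /(congr1 (dcoord 0%N)); rewrite !le_truncE !dcoord_dinj /= => /(congr1 (dcoord (l : {classic L}))).
rewrite !dcoord_dinj eqxx; case: eqP => // _ /eqP.
by rewrite (negPf (gen_neq0 R)).
Qed.

(** A chain in [limit_model] carries maps between all pairs of indices. Truncation is the inclusion
    when [i <= j], and in the other direction the projection that splits it. *)
Definition le_map i j (x : le_mod i) : le_mod j := le_trunc j (le_incl x).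

Lemma le_map_lin i j : is_lin (@le_map i j).
Proof. by move=> a x y; rewrite /le_map le_incl_lin le_trunc_lin. Qed.

Lemma le_map_incl i j x : (i <= j)%N -> le_incl (@le_map i j x) = le_incl x.
Proof. exact: le_truncK. Qed.

Lemma le_map_pure i j : (i <= j)%N -> pure_emb (@le_map i j).
Proof.
move=> ij; apply: (pure_split (@le_map_lin i j) (@le_map_lin j i)) => x.
apply: le_incl_inj; apply: dsum_eq => k; rewrite le_truncE le_map_incl//.
by case: leqP => // ik; rewrite le_inclP.
Qed.

(** An extension of [le_mod n] splits by [pss]; the projection [c] onto the complement, followed by
    the embedding [sigma] of the whole extension in [fpsum], fills the new coordinate [n.+1]. *)
Lemma le_map_universal n : universal_over (@RMod R) L (@le_map n n.+1).
Proof.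
split; [by []|split; [by []|split; [exact: has_size_le_mod|split; [exact: has_size_le_mod|]]]].
split; first exact: le_map_pure.
move=> Ns es _ NsL esp; have [r [rl rK]] := pss esp.
have [sigma [pi [sl pl sK]]] := split_fpsum (has_size_le NsL).
pose c y := y - es (r y).
have cl : is_lin c.
  by move=> a x y; rewrite /c rl esp.1 scalerBr opprD addrACA.
have ces x : c (es x) = 0 by rewrite /c rK subrr.
pose h0 y := le_incl (r y) + dinj n.+1 (sigma (c y)).
have h0l : is_lin h0.
  move=> a x y; rewrite /h0 cl sl dinj_lin rl le_incl_lin.
  by rewrite scalerDr addrACA.
pose h y := le_trunc n.+1 (h0 y).
have h0E y k : dcoord k (h0 y) = if (k <= n)%N then dcoord k (le_incl (r y))
    else if k == n.+1 then sigma (c y) else 0.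
  rewrite /h0 (is_linD _ _ (dcoord_lin k)) dcoord_dinj; case: leqP => kn.
    by rewrite ltn_eqF ?addr0// ltnS.
  by rewrite le_inclP// add0r.
have hE y : le_incl (h y) = h0 y.
  apply: dsum_eq => k; rewrite le_truncE; case: leqP => // nk.
  by rewrite h0E leqNgt (ltnW nk) gtn_eqF.
exists h; split; last first.
  move=> x; apply: le_incl_inj; rewrite hE /h0 ces rK (is_lin0 sl) (is_lin0 (@dinj_lin _ _ _ _)).
  by rewrite addr0 le_map_incl.
(* The retraction: it reads the first coordinates back through [es] and the last one through
   [pi]. *)
pose q (z : le_mod n.+1) : Ns := es (le_trunc n (le_incl z)) + pi (dcoord n.+1 (le_incl z)).
apply: (@pure_split _ _ _ _ q) => [a x y|a x y|y].
- by rewrite /h h0l le_trunc_lin.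
- rewrite /q le_incl_lin le_trunc_lin dcoord_lin esp.1 pl.
  by rewrite scalerDr addrACA.
rewrite /q hE h0E ltnn eqxx sK.
have -> : le_trunc n (h0 y) = r y.
  apply: le_incl_inj; apply: dsum_eq => k; rewrite le_truncE h0E.
  by case: leqP => // nk; rewrite le_inclP.
by rewrite /c addrC subrK.
Qed.

Lemma limit_model_fpsumN : limit_model (@RMod R) L fpsumN.
Proof.
split=> //; exists nat, (fun i j : nat => (i < j)%N), le_mod, le_map, le_incl.
have ltn_lim : limit_ordinal_below_succ L (fun i j : nat => (i < j)%N).
  split; first by move=> n; elim/ltn_ind: n => n IHn; constructor; exact: IHn.
  split; first by move=> i; rewrite ltnn.
  split; first by move=> i j k; exact: ltn_trans.
  split; first by move=> i j; case: (ltngtP i j) => ij; [left|right; right|right; left].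
  split; first by constructor; exact: 0%N.
  by split=> // i; exists i.+1.
have ordE i j : ord_le (fun i j : nat => (i < j)%N) i j -> (i <= j)%N.
  by move=> [/ltnW|->].
split=> //; split; first by move=> i; split=> //; exact: has_size_le_mod.
split; first by move=> i j /ordE; exact: le_map_pure.
split; first by move=> i x; apply: le_incl_inj; rewrite le_map_incl.
split.
  move=> i j k x /ordE ij /ordE jk; apply: le_incl_inj.
  by rewrite !le_map_incl//; exact: leq_trans jk.
split.
  move=> [|i] [[j ji] lim] //; have [k [ik ki]] := lim i (ltnSn i).
  by move: ki; rewrite ltnNge ik.
split.
  move=> i j [ij nk]; have -> : j = i.+1; last exact: le_map_universal.
  apply/eqP; rewrite eqn_leq ij andbT leqNgt; apply/negP => iij.
  by apply: nk; exists i.+1.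
split.
  move=> i; apply: (@pure_split _ _ _ _ (le_trunc i)) => [||x].
  - exact: le_incl_lin.
  - exact: le_trunc_lin.
  - by apply: le_incl_inj; rewrite le_truncK.
split; first by move=> i j x /ordE ij; rewrite le_map_incl.
move=> x; have [s sx] := dsum_support x; pose n := \max_(k <- s) k.
exists n, (le_trunc n x); apply: dsum_eq => k; rewrite le_truncE; case: leqP => // nk.
rewrite sx//; apply/negP => ks; move: nk; rewrite ltnNge /n.
by rewrite (leq_bigmax_seq (F := id) k ks isT).
Qed.

End PureSemisimple.

Lemma pure_semisimple_superstable (R : nzRingType) :
  left_pure_semisimple R -> superstable (RMod (R:=R)).
Proof.
move=> pss; exists (nat + lsys R)%type => L muL.
have Linf : card_le nat L by apply: cardle_trans muL; exists inl => x y [].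
have sysL : card_le (lsys R) L by apply: cardle_trans muL; exists inr => x y [].
split; first by exists (fpsumN R L); exact: limit_model_fpsumN.
move=> M1 M2 /(limit_model_iso pss Linf sysL) i1 /(limit_model_iso pss Linf sysL) i2.
exact: iso_trans i1 (iso_sym i2).
Qed.

Lemma pure_semisimple_Rlpi (R : nzRingType) :
  left_pure_semisimple R -> Rlpi (R:=R) = RMod (R:=R).
Proof.
move=> pss; apply/funext => M; apply/propext; split=> // _ n t.
exists M, id; split; first exact: pure_id.
by split=> // k; exists (t k).
Qed.

Theorem theorem3p20 (R : nzRingType) :
  (left_pure_semisimple R <-> superstable (RMod (R:=R))) /\
  (superstable (RMod (R:=R)) <-> superstable (Rlpi (R:=R))).
Proof.
have mod_pss : superstable (RMod (R:=R)) -> left_pure_semisimple R.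
  exact: superstable_pure_semisimple.
have lpi_pss : superstable (Rlpi (R:=R)) -> left_pure_semisimple R.
  exact: superstable_pure_semisimple.
split; first by split=> [/pure_semisimple_superstable|].
split=> [sup|/lpi_pss/pure_semisimple_superstable//].
by rewrite pure_semisimple_Rlpi//; exact: mod_pss.
Qed.
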